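(* The 1-DFLP-CCD with loyal customers is polynomially solvable.
   Context: **1-DFLP-CCD** (single-facility Dynamic Facility Location Problem under Cumulative Customer Demand). *Instance:* finite sets $\mathcal{T}=\{1,\ldots,T\}$ (time periods), $\mathcal{I}=\{1,\ldots,I\}$ (locations), $\mathcal{J}=\{1,\ldots,J\}$ (customers); positive rationals $r_i$ ($i\in\mathcal{I}$); nonnegative rationals $d^t_j$ ($j\in\mathcal{J},t\in\mathcal{T}$); binary values $a_{ij}$ ($i\in\mathcal{I},j\in\mathcal{J}$; $a_{ij}=1$ means that $j$ is willing to attend location $i$). A feasible location policy is $\boldsymbol y\in\{0,1\}^{\mathcal{I}\times\mathcal{T}}$ with $\sum_{i\in\mathcal{I}}y^t_i\le1$ for all $t\in\mathcal{T}$. Define $u^0_j=0$, $c^t_j=u^{t-1}_j+d^t_j$, $u^t_j=\bigl(1-\max_{i\in\mathcal{I}}a_{ij}y^t_i\bigr)c^t_j$ for $t\in\mathcal{T}$. The objective value is $z(\boldsymbol y)=\sum_{t\in\mathcal{T}}\sum_{i\in\mathcal{I}}\sum_{j\in\mathcal{J}}r_ia_{ij}y^t_ic^t_j$. The problem is to find a feasible location policy maximizing $z(\boldsymbol y)$. An instance has *loyal customers* if every customer is willing to attend exactly one location: $\sum_{i\in\mathcal{I}}a_{ij}=1$ for all $j\in\mathcal{J}$. *)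

(* Defs.v *)
From HB Require Import structures.
From mathcomp Require Import all_boot all_order all_algebra.

Set Implicit Arguments.
Unset Strict Implicit.
Unset Printing Implicit Defensive.

Import Order.TTheory GRing.Theory Num.Theory.
Local Open Scope ring_scope.

Inductive move := MoveL | MoveN | MoveR.

(** Deterministic multi-tape Turing machines.  The input and the output are bit
    strings, both on tape [ord0]; [tm_extra] is the rest of the tape alphabet
    and [None] is the blank. *)
Record tm := TM {
  tm_tapes : nat;
  tm_extra : finType;
  tm_state : finType;
  tm_start : tm_state;
  tm_halt : pred tm_state;
  tm_delta : tm_state ->
    {ffun 'I_tm_tapes.+1 -> option (bool + tm_extra)} ->
    tm_state * {ffun 'I_tm_tapes.+1 -> option (bool + tm_extra) * move}
}.

Definition symbol (M : tm) : finType := option (bool + tm_extra M).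

(** A tape infinite in both directions: [tape_left] lists the cells strictly to
    the left of the head, nearest first, and [tape_right] the scanned cell and
    the cells to its right.  All the cells that are not listed are blank. *)
Record tape (M : tm) := Tape {
  tape_left : seq (symbol M);
  tape_right : seq (symbol M)
}.

Section Machine.
Variable M : tm.

Definition tape_read (t : tape M) : symbol M := head None (tape_right t).

Definition tape_write (s : symbol M) (t : tape M) : tape M :=
  Tape (tape_left t) (s :: behead (tape_right t)).

Definition tape_move (m : move) (t : tape M) : tape M :=
  match m with
  | MoveL => Tape (behead (tape_left t))
                  (head None (tape_left t) :: tape_right t)
  | MoveN => t
  | MoveR => Tape (tape_read t :: tape_left t) (behead (tape_right t))
  end.

Record config := Config {
  cf_state : tm_state M;
  cf_tapes : {ffun 'I_(tm_tapes M).+1 -> tape M}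
}.

(** Halting configurations are fixed, so that [iter n tm_step c] is a halting
    configuration iff the machine halts from [c] after at most [n] steps. *)
Definition tm_step (c : config) : config :=
  if tm_halt (cf_state c) then c else
  let qa := tm_delta (cf_state c) [ffun k => tape_read (cf_tapes c k)] in
  Config qa.1
    [ffun k => tape_move (qa.2 k).2 (tape_write (qa.2 k).1 (cf_tapes c k))].

Definition tm_init (w : seq bool) : config :=
  Config (tm_start M)
    [ffun k => if k == ord0 then Tape [::] [seq Some (inl b) | b <- w]
               else Tape [::] [::]].

Fixpoint bit_prefix (s : seq (symbol M)) : seq bool :=
  if s is Some (inl b) :: s' then b :: bit_prefix s' else [::].

(** The output is the longest string of bits that starts at the head. *)
Definition tm_output (c : config) : seq bool :=
  bit_prefix (tape_right (cf_tapes c ord0)).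

End Machine.

(** One machine and one polynomial for all the instances [x] with [D x]: from the
    encoding of [x], the machine outputs the encoding of some solution [y] of
    [x] in time polynomial in the length of its input. *)
Definition polynomially_solvable (X : Type) (D : X -> Prop) (Y : X -> Type)
    (sol : forall x, Y x -> Prop)
    (encX : X -> seq bool) (encY : forall x, Y x -> seq bool) : Prop :=
  exists (M : tm) (p : {poly nat}), forall x : X, D x ->
    let c := iter p.[size (encX x)] (@tm_step M) (tm_init M (encX x)) in
    tm_halt (cf_state c) /\ exists2 y : Y x, sol x y & tm_output c = encY x y.

(** Periods, locations and customers are numbered from 0. *)
Record dflp := Dflp {
  nT : nat;
  nI : nat;
  nJ : nat;
  reward : 'I_nI -> rat;
  demand : 'M[rat]_(nJ, nT);
  attend : 'M[bool]_(nI, nJ);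
  reward_gt0 : forall i, 0 < reward i;
  demand_ge0 : forall j t, 0 <= demand j t
}.

Section Problem.
Variable P : dflp.

Definition policy := 'M[bool]_(nI P, nT P).

Definition feasible (y : policy) : Prop :=
  forall t, (\sum_(i < nI P) (y i t : nat) <= 1)%N.

Definition served (y : policy) (t : 'I_(nT P)) (j : 'I_(nJ P)) : nat :=
  (\max_(i < nI P) (attend P i j * y i t))%N.

(** [unmet y j n] is the demand of [j] left over after the first [n] periods;
    the period numbered [n] is the [n.+1]-st one, and the value is irrelevant
    for [n] larger than the number of periods. *)
Fixpoint unmet (y : policy) (j : 'I_(nJ P)) (n : nat) : rat :=
  if n is n'.+1 then
    if insub n' is Some t then
      (1 - (served y t j)%:R) * (unmet y j n' + demand P j t)
    else 0
  else 0.

Definition cumulated (y : policy) (t : 'I_(nT P)) (j : 'I_(nJ P)) : rat :=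
  unmet y j t + demand P j t.

Definition objective (y : policy) : rat :=
  \sum_(t < nT P) \sum_(i < nI P) \sum_(j < nJ P)
    reward i * (attend P i j)%:R * (y i t)%:R * cumulated y t j.

Definition optimal (y : policy) : Prop :=
  feasible y /\ forall y', feasible y' -> objective y' <= objective y.

Definition loyal : Prop :=
  forall j, (\sum_(i < nI P) (attend P i j : nat) = 1)%N.

End Problem.

Definition enc_unary (n : nat) : seq bool := rcons (nseq n true) false.

(** Binary digits, least significant first, without leading zeros. *)
Definition digits (n : nat) : seq bool :=
  [seq odd (n %/ 2 ^ k) | k <- iota 0 (up_log 2 n.+1)].

(** Self-delimiting: every digit is preceded by [true], and [false] ends the
    number. *)
Definition enc_nat (n : nat) : seq bool :=
  rcons (flatten [seq [:: true; b] | b <- digits n]) false.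

(** For nonnegative rationals only: the sign is dropped. *)
Definition enc_rat (q : rat) : seq bool :=
  enc_nat `|numq q|%N ++ enc_nat `|denq q|%N.

(** The three index sets are given by listing their elements, hence the unary
    dimensions; as soon as the index sets are nonempty, the tables that follow
    have at least as many entries.  Rewards and demands are written in
    binary. *)
Definition enc_dflp (P : dflp) : seq bool :=
  enc_unary (nT P) ++ enc_unary (nI P) ++ enc_unary (nJ P) ++
  flatten [seq enc_rat (reward i) | i <- enum 'I_(nI P)] ++
  flatten [seq enc_rat (demand P j t) |
            j <- enum 'I_(nJ P), t <- enum 'I_(nT P)] ++
  [seq attend P i j | i <- enum 'I_(nI P), j <- enum 'I_(nJ P)].

Definition enc_policy (P : dflp) (y : policy P) : seq bool :=
  [seq y i t | t <- enum 'I_(nT P), i <- enum 'I_(nI P)].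

(* Main.v *)
Require Import Defs.
From mathcomp Require Import all_boot all_order all_algebra.
From mathcomp Require Import zify.

Set Implicit Arguments.
Unset Strict Implicit.
Unset Printing Implicit Defensive.

(** A loyal customer is served at one location only, and a visit of this
    location collects all that its customers have accumulated.  The visits of a
    location thus collect, together, the demand of its customers up to the last
    visit, whatever the earlier visits are ([collected], [objectiveE]).  The
    value of a policy is a sum over the locations of weights that depend on the
    last period of the location only.  The last periods of distinct locations
    are distinct, and every matching of locations with periods comes from a
    policy: the problem is an assignment problem ([matching_optimal]), with the
    periods as rows and the locations as columns, and with rational weights that
    a common denominator makes integral ([scaleE]).

    The assignment problem is solved by the Hungarian method.  A matching and
    potentials of the rows and columns that cover all the weights prove each
    other optimal when the edges of the matching are tight and the unmatched
    rows and columns have potential 0 ([good_optimal]).  Rows are inserted one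
    by one; the search from a new row changes the potentials until it reaches
    either a free column or a row of potential 0.  Instead of augmenting paths,
    it keeps for every row that it reaches a matching of all the other rows,
    which makes the invariant local ([tick_inv]).  The number of steps is at
    most the square of the number of periods, and a step multiplies the
    potentials by at most 4 ([tick_hbound]), so that all the numbers have a
    polynomial number of bits.

    It remains to obtain a Turing machine.  Data of all types are coded by
    binary trees.  A function is in the class [FP] when a program on three
    stacks replaces the code of the argument, on top of the first stack, by the
    code of the result in polynomial time, and leaves everything below
    untouched.  This class is closed under composition, pairing, case analysis
    and, as long as the accumulator stays polynomially small, folds over lists
    ([FP_fold]).  Functions on lists, binary arithmetic ([FP_ripple]), the
    Hungarian method and the reading of an instance belong to it by the
    structure of their definitions, which the tactic [fp] follows.  Programs are
    compiled to machines with one tape for each stack ([compile_correct],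
    [FP_machine]). *)

(** * Programs on three stacks, and their compilation to Turing machines *)

(** The separator [inr tt] delimits the words that lie above each other. *)
Definition sym := (bool + unit)%type.

Definition cell := option sym.

Inductive reg := R0 | R1 | R2.

Definition stacks := (seq sym * seq sym * seq sym)%type.

Definition get (s : stacks) (r : reg) : seq sym :=
  match r with R0 => s.1.1 | R1 => s.1.2 | R2 => s.2 end.

Definition upd (s : stacks) (r : reg) (x : seq sym) : stacks :=
  match r with
  | R0 => (x, s.1.2, s.2)
  | R1 => (s.1.1, x, s.2)
  | R2 => (s.1.1, s.1.2, x)
  end.

Definition reg_idx (r : reg) : 'I_3 :=
  match r with R0 => ord0 | R1 => inord 1 | R2 => inord 2 end.

Definition top (s : stacks) (r : reg) : cell := ohead (get s r).

Inductive prog :=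
  | Push of reg & sym
  | Pop of reg
  | Seq of prog & prog
  | If of reg & pred cell & prog & prog
  | While of reg & pred cell & prog.

(** The count [n] is the exact number of steps of the compiled program, jumps
    included. *)
Inductive exec : prog -> stacks -> nat -> stacks -> Prop :=
  | ExecPush r a s : exec (Push r a) s 2 (upd s r (a :: get s r))
  | ExecPop r s : exec (Pop r) s 1 (upd s r (behead (get s r)))
  | ExecSeq p q s s' s'' m n : exec p s m s' -> exec q s' n s'' ->
      exec (Seq p q) s (m + n) s''
  | ExecIfT r (b : pred cell) p q s s' n : b (top s r) -> exec p s n s' ->
      exec (If r b p q) s (n.+2) s'
  | ExecIfF r (b : pred cell) p q s s' n : ~~ b (top s r) -> exec q s n s' ->
      exec (If r b p q) s (n.+1) s'
  | ExecWhileT r (b : pred cell) p s s' s'' m n : b (top s r) -> exec p s m s' ->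
      exec (While r b p) s' n s'' -> exec (While r b p) s ((m + n).+2) s''
  | ExecWhileF r (b : pred cell) p s : ~~ b (top s r) ->
      exec (While r b p) s 1 s.

Inductive instr :=
  | Op of reg & (cell -> cell) & move
  | Jmp of nat
  | Br of reg & pred cell & nat.

(** Jumps are absolute, hence the address [b] of the code; [Br] jumps when its
    test fails. *)
Fixpoint compile (b : nat) (p : prog) : seq instr :=
  match p with
  | Push r a => [:: Op r id MoveL; Op r (fun=> Some a) MoveN]
  | Pop r => [:: Op r (fun=> None) MoveR]
  | Seq p q => let cp := compile b p in cp ++ compile (b + size cp) q
  | If r t p q =>
      let cp := compile b.+1 p in
      let b' := (b.+1 + size cp).+1 in
      let cq := compile b' q in
      Br r t b' :: cp ++ Jmp (b' + size cq) :: cq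
  | While r t p =>
      let cp := compile b.+1 p in
      Br r t (b.+1 + size cp).+1 :: cp ++ [:: Jmp b]
  end.

Section Compile.
Variable cd : seq instr.

Definition delta (q : 'I_(size cd).+1)
    (rd : {ffun 'I_3 -> option (bool + unit)}) :
    'I_(size cd).+1 * {ffun 'I_3 -> option (bool + unit) * move} :=
  match nth (Jmp 0) cd q with
  | Op r w m => (inord q.+1, [ffun k => if k == reg_idx r then (w (rd k), m)
                                       else (rd k, MoveN)])
  | Jmp a => (inord a, [ffun k => (rd k, MoveN)])
  | Br r t a => (inord (if t (rd (reg_idx r)) then q.+1 else a),
                 [ffun k => (rd k, MoveN)])
  end.

Definition machine : tm :=
  @TM 2 unit 'I_(size cd).+1 ord0 (fun q => q == size cd :> nat) delta.

Definition blank (s : seq cell) := all (pred1 None) s.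

(** The head is on the top of the stack; the blanks [z] are what is left of
    cells that were once used. *)
Definition tape_holds (t : tape machine) (s : seq sym) : Prop :=
  blank (tape_left t) /\ exists2 z, blank z & tape_right t = map Some s ++ z.

Definition represents (c : config machine) (pc : nat) (s : stacks) : Prop :=
  cf_state c = pc :> nat /\
  forall r, tape_holds (cf_tapes c (reg_idx r)) (get s r).

Lemma reg_idxE r r' : reg_idx r = reg_idx r' -> r = r'.
Proof.
by move=> /(congr1 (@nat_of_ord 3)); case: r; case: r';
   rewrite /= ?inordK.
Qed.

Lemma get_upd s r x r' :
  get (upd s r x) r' = if reg_idx r' == reg_idx r then x else get s r'.
Proof.
case: eqP => [/reg_idxE ->|]; first by case: r.
by case: r; case: r' => // ne; case: ne.
Qed.

Lemma tape_holds_write (t : tape machine) s :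
  tape_holds t s -> tape_holds (tape_write (tape_read t) t) s.
Proof.
case=> hl [z hz e]; split=> //; rewrite /tape_write /tape_read /= e.
case: s {e} => [|a s] /=; last by exists z.
by exists (head None z :: behead z) => //; case: z hz => //= a z /andP[].
Qed.

Lemma tape_holds_read (t : tape machine) s :
  tape_holds t s -> tape_read t = ohead s.
Proof.
case=> _ [z hz e]; rewrite /tape_read e; case: s e => //= _.
by case: z hz => //= a z /andP[/eqP].
Qed.

Lemma step_op (c : config machine) pc r w m :
  cf_state c = pc :> nat -> pc < size cd -> nth (Jmp 0) cd pc = Op r w m ->
  let c' := tm_step c in
  cf_state c' = pc.+1 :> nat /\
  forall k, cf_tapes c' k = let t := cf_tapes c k in
    if k == reg_idx r then tape_move m (@tape_write machine (w (tape_read t)) t)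
    else tape_write (tape_read t) t.
Proof.
move=> hpc lt_pc e.
have hF : (cf_state c == size cd :> nat) = false by rewrite hpc ltn_eqF.
rewrite /tm_step /= hF /delta hpc e /=.
by split=> [|k]; rewrite ?inordK // !ffunE; case: ifP.
Qed.

Lemma step_jump (c : config machine) pc s :
  represents c pc s -> pc < size cd ->
  match nth (Jmp 0) cd pc with
  | Op _ _ _ => True
  | Jmp a => a <= size cd -> represents (tm_step c) a s
  | Br r t a => a <= size cd ->
      represents (tm_step c) (if t (top s r) then pc.+1 else a) s
  end.
Proof.
case=> hpc ht lt_pc.
have hF : (cf_state c == size cd :> nat) = false by rewrite hpc ltn_eqF.
rewrite /tm_step /= hF /delta hpc.
have ht' r : tape_holds (tape_write (tape_read (cf_tapes c (reg_idx r)))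
                (cf_tapes c (reg_idx r))) (get s r).
  exact: tape_holds_write.
case: (nth _ cd pc) => [//|a|r t a] ha /=; (split=> [|r'];
  rewrite /= ?ffunE //=); first by rewrite inordK.
by rewrite (tape_holds_read (ht r)); case: ifP => _; rewrite inordK.
Qed.

Definition at_addr (b : nat) (l : seq instr) : Prop :=
  exists pre post, cd = pre ++ l ++ post /\ size pre = b.

Lemma at_addr_cat b l1 l2 :
  at_addr b (l1 ++ l2) -> at_addr b l1 /\ at_addr (b + size l1) l2.
Proof.
case=> pre [post [e <-]]; rewrite /at_addr e; split.
  by exists pre, (l2 ++ post); rewrite -!catA.
by exists (pre ++ l1), post; rewrite -!catA size_cat.
Qed.

Lemma at_addr_cons b i l :
  at_addr b (i :: l) ->
  [/\ b < size cd, nth (Jmp 0) cd b = i & at_addr b.+1 l].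
Proof.
case=> pre [post [e <-]]; rewrite /at_addr e; split.
- by rewrite size_cat /= addnS ltnS leq_addr.
- by rewrite nth_cat ltnn subnn.
- by exists (rcons pre i), post; rewrite cat_rcons size_rcons.
Qed.

Lemma at_addr_le b l : at_addr b l -> b + size l <= size cd.
Proof. by case=> pre [post [-> <-]]; rewrite !size_cat addnA leq_addr. Qed.

(** A push is compiled to a move to the blank cell on the left followed by a
    write, which is why the cells on the left have to stay blank; a pop leaves
    a blank behind it. *)
Lemma compile_correct p s n s' : exec p s n s' ->
  forall b c, at_addr b (compile b p) -> represents c b s ->
  represents (iter n (@tm_step machine) c) (b + size (compile b p)) s'.
Proof.
elim=> {p s n s'} /=.
- move=> r a s b c /at_addr_cons[lt1 e1 /at_addr_cons[lt2 e2 _]] [st ht].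
  have [st1 t1] := step_op st lt1 e1.
  have [st2 t2] := step_op st1 lt2 e2.
  split=> [|r']; first by rewrite st2 addn2.
  rewrite get_upd t2 t1; case: eqP => [/reg_idxE ->|_] /=; last first.
    by do 2![apply: tape_holds_write].
  have [hl [z hz er]] := tape_holds_write (ht r).
  split=> /=.
    by move: hl => /=; case: (tape_left (cf_tapes c _)) => // ? ? /andP[].
  by exists z => //=; rewrite -er.
- move=> r s b c /at_addr_cons[lt1 e1 _] [st ht].
  have [st1 t1] := step_op st lt1 e1.
  split=> [|r']; first by rewrite st1 addn1.
  rewrite get_upd t1; case: eqP => [/reg_idxE ->|_] /=; last exact: tape_holds_write.
  have [hl [z hz er]] := ht r.
  split=> //=; rewrite er; case: (get s r) => [|a s1] /=; last by exists z.
  by exists (behead z) => //; case: (z) hz => // ? ? /andP[].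
- move=> p q s s' s'' m n _ IHp _ IHq b c /at_addr_cat[ap aq] rc.
  by rewrite addnC iterD size_cat addnA; apply/IHq/IHp.
- move=> r t p q s s' n ht _ IH b c /at_addr_cons[lt1 e1].
  move=> /at_addr_cat[ap /at_addr_cons[lt2 e2 aq]] rc.
  have := step_jump rc lt1; rewrite e1 ht => /(_ lt2) rc1.
  rewrite -[tm_step (iter n _ c)]iterS iterSr.
  move: (IH _ _ ap rc1); set c2 := iter n _ _ => rc2.
  have := step_jump rc2 lt2; rewrite e2 size_cat /= !addnS !addSn !addnA.
  by apply; rewrite -!addSn (leq_trans _ (at_addr_le aq)) // !addSn.
- move=> r t p q s s' n ht _ IH b c /at_addr_cons[lt1 e1].
  move=> /at_addr_cat[ap /at_addr_cons[lt2 e2 aq]] rc.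
  have := step_jump rc lt1; rewrite e1 (negPf ht) => /(_ lt2) rc1.
  rewrite -iterS iterSr; move: (IH _ _ aq rc1).
  by rewrite size_cat /= !addnS !addSn !addnA.
- move=> r t p s s' s'' m n ht _ IHp _ IHw b c ab rc.
  have /at_addr_cons[lt1 e1 /at_addr_cat[ap /at_addr_cons[lt2 e2 _]]] := ab.
  have := step_jump rc lt1; rewrite e1 ht => /(_ lt2) rc1.
  have rc2 := IHp _ _ ap rc1.
  have := step_jump rc2 lt2; rewrite e2 => /(_ (ltnW lt1)) rc3.
  have := IHw b _ ab rc3.
  rewrite -!iterS; congr (represents _ _ _).
  by rewrite -iterSr -iterD addnC.
- move=> r t p s ht b c /at_addr_cons[lt1 e1].
  move=> /at_addr_cat[ap /at_addr_cons[lt2 e2 _]] rc.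
  have := step_jump rc lt1; rewrite e1 (negPf ht) => /(_ lt2).
  by rewrite size_cat /= addn1 !addnS addSn.
Qed.
End Compile.

(** Halting configurations are fixed, so that the machine may be run longer
    than needed, for a time [N] that depends on the size of [w] only. *)
Lemma exec_machine p (w w' : seq bool) n N s1 s2 :
  exec p (map inl w, [::], [::]) n (map inl w', s1, s2) -> n <= N ->
  let M := machine (compile 0 p) in
  let c := iter N (@tm_step M) (tm_init M w) in
  tm_halt (cf_state c) /\ tm_output c = w'.
Proof.
move=> ep le_nN M.
have r0 : represents (tm_init M w) 0 (map inl w, [::], [::]).
  have n1 : (inord 1 == ord0 :> 'I_3) = false.
    by apply/eqP => /(congr1 val); rewrite /= inordK.
  have n2 : (inord 2 == ord0 :> 'I_3) = false.
    by apply/eqP => /(congr1 val); rewrite /= inordK.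
  split=> //; case; rewrite ffunE ?n1 ?n2 //=; split=> //; exists [::] => //=.
  by rewrite cats0 -map_comp.
have a0 : at_addr (compile 0 p) 0 (compile 0 p).
  by exists [::], [::]; rewrite cats0.
have [st ht] := compile_correct ep a0 r0; set c := iter n _ _ in st ht.
have hc : tm_halt (cf_state c) by rewrite /= st.
have fix_c k : iter k (@tm_step M) c = c.
  by elim: k => //= k ->; rewrite /tm_step hc.
rewrite -(subnK le_nN) iterD -/c fix_c; split=> //.
have [_ [z hz e]] := ht R0; rewrite /tm_output e /=.
elim: (w') {ep ht e} => [|b v IH] /=; last by rewrite IH.
by case: z hz => //= a z /andP[/eqP->].
Qed.

(** * Trees on stacks *)

(** Costs are bounds from above, so that they can be rounded. *)
Definition run (p : prog) (s : stacks) (n : nat) (s' : stacks) : Prop :=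
  exists2 m, m <= n & exec p s m s'.

Lemma run_le p s m n s' : m <= n -> run p s m s' -> run p s n s'.
Proof. by move=> le_mn [k le_km e]; exists k => //; apply: leq_trans le_mn. Qed.

Lemma run_seq p q s s' s'' m n :
  run p s m s' -> run q s' n s'' -> run (Seq p q) s (m + n) s''.
Proof.
case=> k lk ek [l ll el]; exists (k + l); first exact: leq_add.
exact: ExecSeq ek el.
Qed.

Lemma run_push r a s : run (Push r a) s 2 (upd s r (a :: get s r)).
Proof. by exists 2 => //; constructor. Qed.

Lemma run_pop r s : run (Pop r) s 1 (upd s r (behead (get s r))).
Proof. by exists 1 => //; constructor. Qed.

Lemma run_if r (b : pred cell) p q s s' n :
  (if b (top s r) then run p s n s' else run q s n s') ->
  run (If r b p q) s n.+2 s'.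
Proof.
case: ifPn => hb [k lk ek]; first by exists k.+2 => //; apply: ExecIfT.
by exists k.+1; [rewrite ltnW // !ltnS | apply: ExecIfF].
Qed.

Lemma run_whileT r (b : pred cell) p s s' s'' m n : b (top s r) ->
  run p s m s' -> run (While r b p) s' n s'' ->
  run (While r b p) s (m + n).+2 s''.
Proof.
move=> hb [k lk ek] [l ll el]; exists (k + l).+2; first by rewrite !ltnS leq_add.
exact: ExecWhileT hb ek el.
Qed.

Lemma run_whileF r (b : pred cell) p s : ~~ b (top s r) ->
  run (While r b p) s 1 s.
Proof. by exists 1 => //; constructor. Qed.

(** Trees are the only data.  They are written in prefix order, so that the code
    of a pair is a bit followed by the codes of its components. *)
Inductive tree := Leaf | Node of tree & tree.

Fixpoint enc (t : tree) : seq sym :=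
  if t is Node a b then inl true :: enc a ++ enc b else [:: inl false].

Fixpoint tsize (t : tree) : nat :=
  if t is Node a b then (tsize a + tsize b).+1 else 1.

Lemma size_enc t : size (enc t) = tsize t.
Proof. by elim: t => //= a <- b <-; rewrite size_cat. Qed.

Lemma tsize_gt0 t : 0 < tsize t. Proof. by case: t. Qed.

Definition mark : sym := inr tt.
Definition is1 : pred cell := pred1 (Some (inl true)).
Definition is_bit : pred cell := fun c => if c is Some (inl _) then true else false.

Lemma enc_bits t : all (fun a => is_bit (Some a)) (enc t).
Proof. by elim: t => //= a ha b hb; rewrite all_cat ha hb. Qed.

Fixpoint seqs (p : prog) (l : seq prog) : prog :=
  if l is q :: l' then Seq p (seqs q l') else p.

Definition cpbit r r' := If r is1 (Push r' (inl true)) (Push r' (inl false)).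

Definition mvbit r r' := Seq (cpbit r r') (Pop r).

Definition aux (b : bool) := if b then R2 else R1.

(** [R0] holds the data; the tree on top of it is put aside.  The code of a tree
    is delimited by itself: it is enough to count, in unary, the subtrees that
    remain to be read.  As the tree is moved bit by bit, it comes out reversed,
    and it needs a separator since a reversed code is not delimited any more. *)
Definition stash (b : bool) :=
  let r := aux b in let c := aux (~~ b) in
  seqs (Push r mark) [:: Push c mark; Push c (inl true);
    While c is_bit (seqs (If R0 is1 (Seq (Push r (inl true)) (Push c (inl true)))
                       (Seq (Push r (inl false)) (Pop c))) [:: Pop R0]);
    Pop c].

(** A second move restores the order of a word. *)
Definition flush r r' := Seq (While r is_bit (mvbit r r')) (Pop r).

Definition unstash (b : bool) := flush (aux b) R0.

Definition st (b : bool) (x0 x1 x2 : seq sym) : stacks :=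
  if b then (x0, x2, x1) else (x0, x1, x2).

Ltac step := lazymatch goal with
  | |- run (Push _ _) _ _ _ => exact: run_push
  | |- run (Pop _) _ _ _ => exact: run_pop
  | |- run (Seq _ _) _ _ _ => eapply run_seq; [step | step]
  | |- run (If _ _ _ _) _ _ _ => apply: run_if => /=; step
  | _ => idtac
  end.

Lemma run_stash b t x0 x1 x2 :
  run (stash b) (st b (enc t ++ x0) x1 x2) (20 * tsize t + 20)
      (st b x0 (rev (enc t) ++ mark :: x1) x2).
Proof.
pose W := While (aux (~~ b)) is_bit
  (seqs (If R0 is1 (Seq (Push (aux b) (inl true)) (Push (aux (~~ b)) (inl true)))
           (Seq (Push (aux b) (inl false)) (Pop (aux (~~ b))))) [:: Pop R0]).
(* The continuation [s'] lets the induction run through both subtrees. *)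
have loop : forall u y0 y1 y2 n s',
    run W (st b y0 (rev (enc u) ++ y1) y2) n s' ->
    run W (st b (enc u ++ y0) y1 (inl true :: y2)) (n + 20 * tsize u) s'.
  elim=> [|u IHu v IHv] y0 y1 y2 n s' /= h.
    have {}h : run W (st b y0 (inl false :: y1) y2) n s' by [].
    apply: run_le (_ : (6 + n).+2 <= _) _; first lia.
    apply: run_whileT h; first by case: (b).
    by apply: run_le (_ : (2 + 1).+2 + 1 <= _) _ => //; case: (b) => /=; step.
  rewrite rev_cons rev_cat -cats1 -!catA /= in h.
  apply: run_le (_ : (7 + (n + 20 * tsize v + 20 * tsize u)).+2 <= _) _.
    lia.
  apply: (@run_whileT _ _ _ _
    (st b (enc u ++ enc v ++ y0) (inl true :: y1) (inl true :: inl true :: y2))).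
  - by case: (b).
  - by rewrite -catA; apply: run_le (_ : (2 + 2).+2 + 1 <= _) _ => //;
      case: (b) => /=; step.
  - by apply: IHu; apply: IHv.
rewrite /stash /=.
apply: run_le (_ : 2 + (2 + (2 + ((1 + 20 * tsize t) + 1))) <= _) _; first lia.
do 3![apply: run_seq; first exact: run_push].
apply: (@run_seq _ _ _ (st b x0 (rev (enc t) ++ mark :: x1) (mark :: x2))).
  have := loop t x0 (mark :: x1) (mark :: x2) 1
    (st b x0 (rev (enc t) ++ mark :: x1) (mark :: x2)).
  rewrite /W; case: (b) => /=; apply; exact: run_whileF.
by case: (b); step.
Qed.

Lemma run_cpbit r r' a s : get s r = inl a :: behead (get s r) ->
  run (cpbit r r') s 4 (upd s r' (inl a :: get s r')).
Proof.
move=> e; apply: run_if; rewrite /top e /is1 /=.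
by case: a {e}; exact: run_push.
Qed.

Lemma run_mvbit r r' a v s : r <> r' -> get s r = inl a :: v ->
  run (mvbit r r') s 5 (upd (upd s r v) r' (inl a :: get s r')).
Proof.
move=> ne e; apply: run_le (_ : 4 + 1 <= _) _ => //.
apply: run_seq; first by apply: (@run_cpbit _ _ a); rewrite e.
have -> : upd (upd s r v) r' (inl a :: get s r') =
  upd (upd s r' (inl a :: get s r')) r
    (behead (get (upd s r' (inl a :: get s r')) r)).
  rewrite get_upd; case: eqP => [/reg_idxE//|_]; rewrite e /=.
  by move: ne {e}; case: s => [[? ?] ?]; case: r; case: r'.
exact: run_pop.
Qed.

Lemma run_mvbits r r' w y s : r <> r' -> get s r = w ++ y ->
  ~~ is_bit (ohead y) -> all (fun a => is_bit (Some a)) w ->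
  run (While r is_bit (mvbit r r')) s (8 * size w + 1)
      (upd (upd s r y) r' (rev w ++ get s r')).
Proof.
move=> ne; elim: w s => [|[a|[]] w IH] //= s e hy hw.
  have -> : upd (upd s r y) r' (rev [::] ++ get s r') = s.
    by rewrite /= -e; move: s ne {e}; case=> [[? ?] ?]; case: r; case: r'.
  by apply: run_whileF; rewrite /top e.
apply: run_le (_ : (5 + (8 * size w + 1)).+2 <= _) _; first lia.
apply: run_whileT (run_mvbit ne e) _; first by rewrite /top e.
have := IH (upd (upd s r (w ++ y)) r' (inl a :: get s r')).
have ne' : reg_idx r != reg_idx r' by apply/eqP => /reg_idxE.
rewrite !get_upd eqxx (negPf ne') eqxx rev_cons cat_rcons => /(_ erefl hy hw).
congr (run _ _ _ _).
by move: ne {IH e ne'}; case: s => [[? ?] ?]; case: r; case: r'.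
Qed.

Lemma run_flush r r' w y s : r <> r' ->
  get s r = w ++ mark :: y -> all (fun a => is_bit (Some a)) w ->
  run (flush r r') s (10 * size w + 10)
      (upd (upd s r y) r' (rev w ++ get s r')).
Proof.
move=> ne e hw; apply: run_le (_ : (8 * size w + 1) + 1 <= _) _; first lia.
apply: run_seq; first exact: (run_mvbits ne e).
by move: ne {e}; case: s => [[? ?] ?]; case: r; case: r' => //= _; step.
Qed.

Lemma run_unstash b t x0 x1 x2 :
  run (unstash b) (st b x0 (rev (enc t) ++ mark :: x1) x2) (20 * tsize t + 20)
      (st b (enc t ++ x0) x1 x2).
Proof.
have := @run_flush (aux b) R0 (rev (enc t)) x1
  (st b x0 (rev (enc t) ++ mark :: x1) x2).
rewrite revK size_rev size_enc all_rev enc_bits => h.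
apply: run_le (_ : 10 * tsize t + 10 <= _) _; first lia.
have -> : st b (enc t ++ x0) x1 x2 =
  upd (upd (st b x0 (rev (enc t) ++ mark :: x1) x2) (aux b) x1) R0
  (enc t ++ get (st b x0 (rev (enc t) ++ mark :: x1) x2) R0) by case: (b).
by apply: h; case: (b).
Qed.

Definition discard r := Seq (While r is_bit (Pop r)) (Pop r).

Definition drop_tree := Seq (stash false) (discard R1).

Definition dup_tree := seqs (stash false)
  [:: Push R2 mark;
      While R1 is_bit (Seq (cpbit R1 R0) (Seq (cpbit R1 R2) (Pop R1)));
      Pop R1; Push R1 mark; flush R2 R1; unstash false].

Definition swap_trees :=
  seqs (stash false) [:: stash true; unstash false; unstash true].

Lemma run_drop t x0 x1 x2 :
  run drop_tree (enc t ++ x0, x1, x2) (100 * tsize t + 100) (x0, x1, x2).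
Proof.
apply: run_le (_ : (20 * tsize t + 20) + ((3 * tsize t + 1) + 1) <= _) _; first lia.
apply: run_seq; first exact: (run_stash false).
apply: (@run_seq _ _ _ (x0, mark :: x1, x2)); last exact: run_pop.
have : all (fun a => is_bit (Some a)) (rev (enc t)) by rewrite all_rev enc_bits.
rewrite -size_enc -size_rev; elim: (rev _) => [|a w IH] /=.
  by move=> _; apply: run_whileF.
move=> /andP[ha hw]; apply: run_le (_ : (1 + (3 * size w + 1)).+2 <= _) _; first lia.
by apply: run_whileT (IH hw) => //; apply: run_pop.
Qed.

Lemma run_dup t x0 x1 x2 :
  run dup_tree (enc t ++ x0, x1, x2) (100 * tsize t + 100)
      (enc t ++ enc t ++ x0, x1, x2).
Proof.
apply: run_le (_ : (20 * tsize t + 20) + (2 + ((11 * tsize t + 1) +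
  (1 + (2 + ((10 * tsize t + 10) + (20 * tsize t + 20)))))) <= _) _; first lia.
apply: run_seq; first exact: (run_stash false).
apply: run_seq; first exact: run_push.
apply: (@run_seq _ _ _ (enc t ++ x0, mark :: x1, enc t ++ mark :: x2)).
  rewrite /= -{2 3}[enc t]revK.
  have : all (fun a => is_bit (Some a)) (rev (enc t)) by rewrite all_rev enc_bits.
  rewrite -size_enc -size_rev; elim: (rev _) x0 (mark :: x2) => [|[a|[]] w IH] //= y0 y2.
    by move=> _; apply: run_whileF.
  move=> hw; apply: run_le (_ : ((4 + (4 + 1)) + (11 * size w + 1)).+2 <= _) _; first lia.
  rewrite !rev_cons !cat_rcons; apply: run_whileT (IH _ _ hw) => //.
  apply: run_seq; first exact: (@run_cpbit _ _ a).
  by apply: run_seq; [exact: (@run_cpbit _ _ a) | exact: run_pop].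
apply: run_seq; first exact: run_pop.
apply: run_seq; first exact: run_push.
apply: run_seq; last exact: (run_unstash false).
have := @run_flush R2 R1 (enc t) x2 (enc t ++ x0, mark :: x1, enc t ++ mark :: x2).
by rewrite size_enc /=; apply => //; exact: enc_bits.
Qed.

Lemma run_swap t u x0 x1 x2 :
  run swap_trees (enc t ++ enc u ++ x0, x1, x2)
    (100 * (tsize t + tsize u) + 100) (enc u ++ enc t ++ x0, x1, x2).
Proof.
apply: run_le (_ : (20 * tsize t + 20) + ((20 * tsize u + 20) +
  ((20 * tsize t + 20) + (20 * tsize u + 20))) <= _) _; first lia.
apply: run_seq; first exact: (run_stash false).
apply: run_seq; first exact: (run_stash true).
apply: run_seq; first exact: (run_unstash false _ _ x1).
exact: (run_unstash true).
Qed.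

(** * Polynomial-time functions *)

Class Code (A : Type) := code : A -> tree.

Definition sz {A} {cA : Code A} (x : A) : nat := tsize (code x).

Lemma sz_gt0 A {cA : Code A} (x : A) : 0 < sz x. Proof. exact: tsize_gt0. Qed.

Definition peval (P : {poly nat}) (n : nat) : nat := P.[n]%R.

Definition polyb A {cA : Code A} (F : A -> nat) : Prop :=
  exists P : {poly nat}, forall x, F x <= peval P (sz x).

Lemma horner_le (P : {poly nat}) m n : m <= n -> peval P m <= peval P n.
Proof.
move=> le_mn; elim/poly_ind: P => [|P c IH]; rewrite /peval; first by rewrite !horner0.
rewrite !hornerMXaddC; exact: (leq_add (leq_mul IH le_mn)).
Qed.

Section PolyBounds.
Context {A B : Type} {cA : Code A} {cB : Code B}.

Lemma polyb_le (F G : A -> nat) : polyb G -> (forall x, F x <= G x) -> polyb F.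
Proof. by case=> P hP le; exists P => x; apply: leq_trans (hP x). Qed.

Lemma polyb_const n : polyb (fun _ : A => n).
Proof. by exists (n%:P)%R => x; rewrite /peval hornerC. Qed.

Lemma polyb_sz : polyb (fun x : A => sz x).
Proof. by exists 'X%R => x; rewrite /peval hornerX. Qed.

Lemma polyb_add (F G : A -> nat) : polyb F -> polyb G -> polyb (fun x => F x + G x).
Proof.
by case=> P hP [Q hQ]; exists (P + Q)%R => x; rewrite /peval hornerD; apply: leq_add.
Qed.

Lemma polyb_succ (F : A -> nat) : polyb F -> polyb (fun x => (F x).+1).
Proof.
move=> hF; apply: polyb_le (polyb_add hF (polyb_const 1)) _ => x.
by rewrite addn1.
Qed.

Lemma polyb_mul (F G : A -> nat) : polyb F -> polyb G -> polyb (fun x => F x * G x).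
Proof.
by case=> P hP [Q hQ]; exists (P * Q)%R => x; rewrite /peval hornerM; apply: leq_mul.
Qed.

Lemma polyb_comp (F : B -> nat) (g : A -> B) :
  polyb F -> polyb (fun x => sz (g x)) -> polyb (fun x => F (g x)).
Proof.
case=> P hP [Q hQ]; exists (P \Po Q)%R => x; rewrite /peval horner_comp.
exact: leq_trans (hP _) (horner_le _ (hQ x)).
Qed.

End PolyBounds.

Lemma polyb_horner A (cA : Code A) (P : {poly nat}) (F : A -> nat) :
  polyb F -> polyb (fun x => peval P (F x)).
Proof.
case=> Q hQ; exists (P \Po Q)%R => x; rewrite /peval horner_comp; exact: horner_le.
Qed.

(** The stacks [r0], [r1] and [r2] lie below the data and come out unchanged:
    a program can therefore run while another one keeps its own data on any of
    the three stacks, and three stacks are enough for all programs. *)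
Definition FP A B {cA : Code A} {cB : Code B} (f : A -> B) : Prop :=
  polyb (fun x => sz (f x)) /\
  exists p, exists2 F : A -> nat, polyb F &
    forall x r0 r1 r2,
      run p (enc (code x) ++ r0, r1, r2) (F x) (enc (code (f x)) ++ r0, r1, r2).

Ltac polyb := lazymatch goal with
  | |- polyb (fun _ => ?n) => exact: (polyb_const n)
  | |- polyb (fun x => sz x) => exact: polyb_sz
  | |- polyb (fun x => S (@?F x)) => apply: (@polyb_succ _ _ F); polyb
  | |- polyb (fun x => @?F x + @?G x) => apply: (@polyb_add _ _ F G); polyb
  | |- polyb (fun x => @?F x * @?G x) => apply: (@polyb_mul _ _ F G); polyb
  | |- polyb (fun x => peval ?P (@?F x)) => apply: (@polyb_horner _ _ P F); polyb
  | _ => try assumption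
  end.

#[export] Instance code_unit : Code unit := fun=> Leaf.
#[export] Instance code_bool : Code bool :=
  fun b => if b then Node Leaf Leaf else Leaf.
#[export] Instance code_prod A B (cA : Code A) (cB : Code B) : Code (A * B) :=
  fun x => Node (code x.1) (code x.2).
Fixpoint code_seq_def A (cA : Code A) (s : seq A) : tree :=
  if s is a :: s' then Node (code a) (code_seq_def cA s') else Leaf.
#[export] Instance code_seq A (cA : Code A) : Code (seq A) := code_seq_def cA.
#[export] Instance code_option A (cA : Code A) : Code (option A) :=
  fun o => if o is Some a then Node (code a) Leaf else Leaf.

Lemma sz_pair A B {cA : Code A} {cB : Code B} (x : A * B) :
  sz x = (sz x.1 + sz x.2).+1.
Proof. by []. Qed.

Lemma sz_cons A {cA : Code A} (a : A) s : sz (a :: s) = (sz a + sz s).+1.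
Proof. by []. Qed.

Section Combinators.
Context {A B C : Type} {cA : Code A} {cB : Code B} {cC : Code C}.

Lemma FP_ext (f g : A -> B) : f =1 g -> FP f -> FP g.
Proof.
move=> e [hs [p [F hF hp]]]; split; first by apply: polyb_le hs _ => x; rewrite e.
by exists p, F => // x r0 r1 r2; rewrite -e.
Qed.

(** A program depends on the codes only, not on the types. *)
Lemma FP_code_eq (f : A -> B) (g : A -> C) :
  (forall x, code (f x) = code (g x)) -> FP f -> FP g.
Proof.
move=> e [hs [p [F hF hp]]]; split; first by apply: polyb_le hs _ => x; rewrite /sz e.
by exists p, F => // x r0 r1 r2; rewrite -e.
Qed.

Lemma FP_recode (f : A -> B) : (forall x, code (f x) = code x) -> FP f.
Proof.
move=> e; split; first by apply: polyb_le polyb_sz _ => x; rewrite /sz e.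
exists (Seq (Push R2 mark) (Pop R2)), (fun=> 2 + 1); first exact: polyb_const.
move=> x r0 r1 r2; rewrite e.
by apply: run_seq; [exact: run_push | exact: run_pop].
Qed.

Lemma FP_comp (f : B -> C) (g : A -> B) : FP f -> FP g -> FP (fun x => f (g x)).
Proof.
move=> [sf [p [F hF hp]]] [sg [q [G hG hq]]]; split.
  exact: (polyb_comp sf sg).
exists (Seq q p), (fun x => G x + F (g x)).
  by apply: polyb_add => //; exact: polyb_comp hF sg.
by move=> x r0 r1 r2; apply: run_seq.
Qed.

Fixpoint push_word (w : seq sym) : prog :=
  if w is a :: w' then Seq (push_word w') (Push R0 a)
  else Seq (Push R2 mark) (Pop R2).

Lemma run_push_word w r0 r1 r2 :
  run (push_word w) (r0, r1, r2) (2 * size w + 3) (w ++ r0, r1, r2).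
Proof.
elim: w => [|a w IH] /=.
  by apply: (@run_seq _ _ _ _ _ 2 1); [exact: run_push | exact: run_pop].
rewrite mulnS addnC addnA addnC addnA.
apply: run_le (_ : (2 * size w + 3) + 2 <= _) _; first lia.
by apply: run_seq; [exact: IH | exact: run_push].
Qed.

Lemma FP_const (b : B) : FP (fun _ : A => b).
Proof.
split; first exact: polyb_const.
exists (Seq drop_tree (push_word (enc (code b)))),
  (fun x => (100 * sz x + 100) + (2 * sz b + 3)); first by polyb.
move=> x r0 r1 r2; apply: run_seq; first exact: run_drop.
by have := run_push_word (enc (@code _ cB b)) r0 r1 r2; rewrite size_enc.
Qed.

Lemma FP_pair (f : A -> B) (g : A -> C) : FP f -> FP g -> FP (fun x => (f x, g x)).
Proof.
move=> [sf [p [F hF hp]]] [sg [q [G hG hq]]]; split.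
  by apply: polyb_le (polyb_add (polyb_add sf sg) (polyb_const 1)) _ => x;
    rewrite sz_pair addn1.
exists (seqs dup_tree [:: q; swap_trees; p; Push R0 (inl true)]),
  (fun x => (100 * sz x + 100) + (G x +
    ((100 * (sz (g x) + sz x) + 100) + (F x + 2)))); first by polyb.
move=> x r0 r1 r2; apply: run_seq; first exact: run_dup.
apply: run_seq; first exact: hq.
apply: run_seq; first exact: run_swap.
apply: run_seq; first exact: hp.
by rewrite /= -catA; exact: run_push.
Qed.

End Combinators.

Lemma enc_node t u r : enc (Node t u) ++ r = inl true :: enc t ++ enc u ++ r.
Proof. by rewrite /= -catA. Qed.

Lemma FP_id A (cA : Code A) : FP (fun x : A => x).
Proof. exact: FP_recode. Qed.

Lemma FP_fst A B (cA : Code A) (cB : Code B) : FP (fun x : A * B => x.1).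
Proof.
split; first by apply: polyb_le polyb_sz _ => x; rewrite sz_pair; lia.
exists (Seq (Pop R0) (Seq swap_trees drop_tree)),
  (fun x => 1 + ((100 * (sz x) + 100) + (100 * sz x + 100))); first by polyb.
move=> [a b] r0 r1 r2; apply: run_seq; first exact: run_pop.
rewrite sz_pair /= -catA; apply: run_seq.
  by apply: run_le (run_swap _ _ _ _ _); rewrite /sz; lia.
by apply: run_le (run_drop _ _ _ _); rewrite /sz; lia.
Qed.

Lemma FP_snd A B (cA : Code A) (cB : Code B) : FP (fun x : A * B => x.2).
Proof.
split; first by apply: polyb_le polyb_sz _ => x; rewrite sz_pair; lia.
exists (Seq (Pop R0) drop_tree),
  (fun x => 1 + (100 * sz x + 100)); first by polyb.
move=> [a b] r0 r1 r2; apply: run_seq; first exact: run_pop.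
rewrite sz_pair /= -catA; apply: run_le (run_drop _ _ _ _); rewrite /sz; lia.
Qed.

(** The code of a nonempty list is also that of the pair of its head and its
    tail, so that no work is needed to give them to [g]. *)
Lemma FP_case A B X (cA : Code A) (cB : Code B) (cX : Code X)
    (l : X -> seq A) (f : X -> B) (g : X * (A * seq A) -> B) :
  FP l -> FP f -> FP g ->
  FP (fun x => if l x is a :: s then g (x, (a, s)) else f x).
Proof.
move=> [sl [p [L hL hp]]] [sf [q [F hF hq]]] [sg [r [G hG hr]]].
have [Q hQ] := sg; have [R hR] := hG.
have sarg x a s : l x = a :: s -> sz (x, (a, s)) <= sz x + sz (l x) + 1.
  by move->; rewrite !sz_pair /= sz_cons; lia.
split.
  apply: polyb_le (polyb_add sf (polyb_horner Q
    (polyb_add (polyb_add polyb_sz sl) (polyb_const 1)))) _ => x.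
  case e: (l x) => [|a s]; first exact: leq_addr.
  rewrite (leq_trans (hQ _)) // (leq_trans _ (leq_addl _ _)) //.
  by rewrite -e; apply: horner_le; apply: sarg.
exists (Seq dup_tree (Seq p (If R0 is1
  (Seq swap_trees (Seq (Push R0 (inl true)) r))
  (Seq (Pop R0) q)))),
  (fun x => (100 * sz x + 100) + (L x +
    (((100 * (sz (l x) + sz x) + 100) + (2 + peval R (sz x + sz (l x) + 1))) +
       (1 + F x)).+2)).
  by polyb.
move=> x r0 r1 r2; apply: run_seq; first exact: run_dup.
apply: run_seq; first exact: hp.
apply: run_if; case e: (l x) => [|a s].
  apply: run_le (_ : 1 + F x <= _) _; first lia.
  by apply: run_seq; [exact: run_pop | exact: hq].
apply: run_le (leq_addr _ _) _.
apply: (@run_seq _ _ _ (enc (code x) ++ enc (code (a :: s)) ++ r0, r1, r2)).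
  exact: (run_swap (code (a :: s))).
apply: run_seq; first exact: run_push.
apply: run_le (_ : G (x, (a, s)) <= _) _.
  by rewrite (leq_trans (hR _)) //; apply: horner_le; rewrite -e; apply: sarg.
have := hr (x, (a, s)) r0 r1 r2.
have E : code (x, (a, s)) = Node (code x) (code (a :: s)) by [].
by rewrite E enc_node.
Qed.

Section Foldl.
Context {X A S : Type} {cX : Code X} {cA : Code A} {cS : Code S}.

(** The stack holds, from its top, the list [a :: l], the context [x] and the
    accumulator [s].  The context is duplicated, since [pg] consumes it, and
    [l] and the copy are put aside while [pg] runs on the nested pair of [x],
    [a] and [s]. *)
Definition fold_body (pg : prog) := seqs (Pop R0)
  [:: swap_trees; stash false; swap_trees; dup_tree; stash false; stash false;
      Push R0 (inl true); unstash false; Push R0 (inl true); pg; unstash false;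
      unstash false].

Lemma run_fold_body (pg : prog) (x a s s' l : tree) n r0 r1 r2 :
  (forall r1, run pg (enc (Node x (Node a s)) ++ r0, r1, r2) n (enc s' ++ r0, r1, r2)) ->
  run (fold_body pg) (enc (Node a l) ++ enc x ++ enc s ++ r0, r1, r2)
    (1000 * (tsize x + tsize (Node a l) + tsize s) + 1000 + n)
    (enc l ++ enc x ++ enc s' ++ r0, r1, r2).
Proof.
move=> hg.
apply: run_le (_ : 1 + ((100 * (tsize a + tsize l) + 100) + ((20 * tsize l + 20) +
  ((100 * (tsize a + tsize x) + 100) + ((100 * tsize x + 100) + ((20 * tsize x + 20) +
  ((20 * tsize x + 20) + (2 + ((20 * tsize x + 20) + (2 + (n + ((20 * tsize x + 20) +
  (20 * tsize l + 20)))))))))))) <= _) _.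
  rewrite /=; lia.
rewrite enc_node.
apply: run_seq; first exact: run_pop.
apply: run_seq; first exact: run_swap.
apply: run_seq; first exact: (run_stash false).
apply: run_seq; first exact: run_swap.
apply: run_seq; first exact: run_dup.
apply: run_seq; first exact: (run_stash false).
apply: run_seq; first exact: (run_stash false).
apply: run_seq; first exact: run_push.
apply: run_seq; first exact: (run_unstash false x).
apply: run_seq; first exact: run_push.
apply: run_seq.
  have := hg (rev (enc x) ++ mark :: rev (enc l) ++ mark :: r1).
  by rewrite !enc_node; exact.
apply: run_seq; first exact: (run_unstash false x).
exact: (run_unstash false l).
Qed.

(** The only way for a fold of polynomial steps to take more than polynomial
    time is that its accumulator grows, as when a step squares it.  Hence the
    bound [B] on the accumulators of all the prefixes of the list. *)
Lemma FP_fold (l : X -> seq A) (s0 : X -> S) (g : X * (A * S) -> S) (B : X -> nat) :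
  FP l -> FP s0 -> FP g -> polyb B ->
  (forall x k, sz (foldl (fun s a => g (x, (a, s))) (s0 x) (take k (l x))) <= B x) ->
  FP (fun x => foldl (fun s a => g (x, (a, s))) (s0 x) (l x)).
Proof.
move=> [sl [pl [L hL hl]]] [ss [ps [F hF hs]]] [sg [pg [G [PG hG] hg]]] hB hb.
set h := fun x => _; have sh x : sz (h x) <= B x.
  by rewrite /h -[l x]take_size; apply: hb.
split; first exact: polyb_le sh.
pose lsz x := @sz _ (code_seq cA) (l x).
pose N x := 1000 * (@sz _ cX x + lsz x + B x) + 1000 +
  peval PG (@sz _ cX x + lsz x + B x + 2).
exists (seqs dup_tree [:: ps; swap_trees; dup_tree; pl;
          While R0 is1 (fold_body pg); Pop R0; drop_tree]).
exists (fun x => (100 * sz x + 100) + (F x + ((100 * (sz (s0 x) + sz x) + 100) +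
  ((100 * sz x + 100) + (L x + ((lsz x * (N x + 2) + 1) + (1 + (100 * sz x + 100)))))))).
  by rewrite /N /lsz; polyb.
move=> x r0 r1 r2; apply: run_seq; first exact: run_dup.
apply: run_seq; first exact: hs.
apply: run_seq; first exact: run_swap.
apply: run_seq; first exact: run_dup.
apply: run_seq; first exact: hl.
apply: (@run_seq _ _ _ (enc (code ([::] : seq A)) ++ enc (code x) ++
  enc (code (h x)) ++ r0, r1, r2)); last first.
  by apply: run_seq; [exact: run_pop | exact: run_drop].
rewrite /h; set st := fun s a => _.
have loop m d s : d ++ m = l x -> foldl st (s0 x) d = s ->
    run (While R0 is1 (fold_body pg))
      (enc (code m) ++ enc (code x) ++ enc (code s) ++ r0, r1, r2)
      (sz m * (N x + 2) + 1)
      (enc (code ([::] : seq A)) ++ enc (code x) ++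
         enc (code (foldl st (s0 x) (l x))) ++ r0, r1, r2); last first.
  exact: (loop (l x) [::] (s0 x)).
elim: m d s => [|a m IH] d s ed es.
  rewrite cats0 in ed; rewrite -ed es.
  by apply: run_le (_ : 1 <= _) _; [rewrite addn1 | apply: run_whileF].
have ss_le : sz s <= B x.
  by rewrite -es; have := hb x (size d); rewrite -ed take_size_cat.
have le_m : (sz a + sz m).+1 <= sz (l x).
  have le_app d' : sz (a :: m) <= sz (d' ++ a :: m).
    by elim: d' => // b d' IH'; rewrite cat_cons (sz_cons b); lia.
  by rewrite -ed; exact: le_app.
have sa : sz (a :: m) = (sz a + sz m).+1 by [].
have sa0 := sz_gt0 a.
apply: run_le (_ : (N x + (sz m * (N x + 2) + 1)).+2 <= _) _.
  rewrite sa; lia.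
apply: (@run_whileT _ _ _ _ (enc (code m) ++ enc (code x) ++
  enc (code (st s a)) ++ r0, r1, r2)) => //.
  have := @run_fold_body pg (code x) (code a) (code s) (code (st s a)) (code m)
    (G (x, (a, s))) r0 r1 r2.
  case=> [r1'|k lk ek]; first exact: (hg (x, (a, s))).
  exists k; last exact: ek; apply: leq_trans lk _.
  have sum_le : 1000 * (sz x + sz (a :: m) + sz s) + 1000 <=
      1000 * (sz x + lsz x + B x) + 1000 by rewrite /lsz; lia.
  rewrite leq_add //.
  rewrite (leq_trans (hG _)) //; apply: horner_le; rewrite !sz_pair /=; lia.
by apply: (IH (rcons d a)); rewrite ?cat_rcons // foldl_rcons es.
Qed.

End Foldl.

Lemma FP_foldl X A S (cX : Code X) (cA : Code A) (cS : Code S)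
    (B : X -> nat) (l : X -> seq A) (s0 : X -> S) (f : X -> S -> A -> S) :
  FP l -> FP s0 -> FP (fun y : X * (A * S) => f y.1 y.2.2 y.2.1) -> polyb B ->
  (forall x k, sz (foldl (f x) (s0 x) (take k (l x))) <= B x) ->
  FP (fun x => foldl (f x) (s0 x) (l x)).
Proof. exact: FP_fold. Qed.

(** * Lists *)

Section Sizes.
Context {A B : Type} {cA : Code A} {cB : Code B}.

Lemma sz_cat (s t : seq A) : (sz (s ++ t)).+1 = sz s + sz t.
Proof. by elim: s => [|a s IH]; rewrite ?cat_cons ?(sz_cons a) //; lia. Qed.

Lemma sz_rev (s : seq A) : sz (rev s) = sz s.
Proof.
elim: s => [|a s IH] //; rewrite rev_cons -cats1 sz_cons.
have := sz_cat (rev s) [:: a]; rewrite (sz_cons a) IH.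
have -> : sz ([::] : seq A) = 1 by []; lia.
Qed.

Lemma size_le_sz (s : seq A) : size s < sz s.
Proof. by elim: s => // a s IH; rewrite sz_cons /=; lia. Qed.

Lemma sz_take (s : seq A) k : sz (take k s) <= sz s.
Proof.
have := sz_cat (take k s) (drop k s); rewrite cat_take_drop.
have : 0 < sz (drop k s) by exact: sz_gt0.
lia.
Qed.

Lemma sz_nth_lt a0 (s : seq A) i : i < size s -> sz (nth a0 s i) < sz s.
Proof.
elim: s i => [|a s IH] [|i] //=; rewrite sz_cons => hi; first by lia.
by have := IH i hi; lia.
Qed.

Lemma sz_map_le M (f : A -> B) (s : seq A) :
  (forall i, i < size s -> forall a0, sz (f (nth a0 s i)) <= M) ->
  sz (map f s) <= size s * M.+1 + 1.
Proof.
elim: s => [|a s IH] h //; rewrite map_cons sz_cons /= mulSn.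
have := IH (fun i hi a0 => h i.+1 hi a0); have /= := h 0 isT a.
move: (size s * _) => n; lia.
Qed.

Lemma sz_filter p (s : seq A) : sz (filter p s) <= sz s.
Proof.
by elim: s => //= a s IH; case: (p a); rewrite ?(sz_cons a); lia.
Qed.

End Sizes.

Section Basic.
Context {X A B : Type} {cX : Code X} {cA : Code A} {cB : Code B}.

Lemma FP_app2 C (cC : Code C) (h : A -> B -> C) (f : X -> A) (g : X -> B) :
  FP (fun p => h p.1 p.2) -> FP f -> FP g -> FP (fun x => h (f x) (g x)).
Proof. by move=> hh hf hg; exact: FP_comp hh (FP_pair hf hg). Qed.

Lemma FP_fst_of (f : X -> A * B) : FP f -> FP (fun x => (f x).1).
Proof. by move=> hf; exact: FP_comp (FP_fst _ _) hf. Qed.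

Lemma FP_snd_of (f : X -> A * B) : FP f -> FP (fun x => (f x).2).
Proof. by move=> hf; exact: FP_comp (FP_snd _ _) hf. Qed.

Lemma FP_cons (a : X -> A) (l : X -> seq A) :
  FP a -> FP l -> FP (fun x => a x :: l x).
Proof.
move=> ha hl.
have h : FP (fun p : A * seq A => p.1 :: p.2) by apply: FP_recode.
exact: FP_comp h (FP_pair ha hl).
Qed.

Lemma FP_Some (a : X -> A) : FP a -> FP (fun x => Some (a x)).
Proof.
move=> ha; have h : FP (fun p : A * unit => Some p.1).
  by apply: FP_recode => -[a' []].
exact: FP_comp h (FP_pair ha (FP_const tt)).
Qed.

Lemma FP_head (d : X -> A) (l : X -> seq A) :
  FP d -> FP l -> FP (fun x => head (d x) (l x)).
Proof.
move=> hd hl; have h : FP (fun y : X * (A * seq A) => y.2.1).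
  exact: FP_comp (FP_fst _ _) (FP_snd _ _).
by apply: FP_ext (FP_case hl hd h) => x; case: (l x).
Qed.

Lemma FP_behead (l : X -> seq A) : FP l -> FP (fun x => behead (l x)).
Proof.
move=> hl; have h : FP (fun y : X * (A * seq A) => y.2.2).
  exact: FP_comp (FP_snd _ _) (FP_snd _ _).
by apply: FP_ext (FP_case hl (FP_const [::]) h) => x; case: (l x).
Qed.

Lemma FP_oapp (o : X -> option A) (g : X -> A -> B) (d : X -> B) :
  FP o -> FP (fun y : X * A => g y.1 y.2) -> FP d ->
  FP (fun x => oapp (g x) (d x) (o x)).
Proof.
move=> ho hg hd.
have h : FP (fun o : option A => if o is Some a then [:: a] else [::]).
  by apply: FP_recode; case.
have g' : FP (fun y : X * (A * seq A) => g y.1 y.2.1).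
  apply: (FP_comp (f := fun y : X * A => g y.1 y.2)
            (g := fun y : X * (A * seq A) => (y.1, y.2.1))) => //.
  by apply: FP_pair; [exact: FP_fst | exact: FP_comp (FP_fst _ _) (FP_snd _ _)].
by apply: FP_ext (FP_case (FP_comp h ho) hd g') => x; case: (o x).
Qed.

Lemma FP_if (b : X -> bool) (f g : X -> A) :
  FP b -> FP f -> FP g -> FP (fun x => if b x then f x else g x).
Proof.
move=> hb hf hg.
have h : FP (fun b : bool => if b then [:: tt] else [::]).
  by apply: FP_recode; case.
have f' : FP (fun y : X * (unit * seq unit) => f y.1).
  exact: FP_comp hf (FP_fst _ _).
by apply: FP_ext (FP_case (FP_comp h hb) hg f') => x; case: (b x).
Qed.

End Basic.

Section Bool.
Context {X : Type} {cX : Code X}.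
Implicit Types f g : X -> bool.

Lemma FP_negb f : FP f -> FP (fun x => ~~ f x).
Proof.
move=> hf; apply: FP_ext (FP_if hf (FP_const false) (FP_const true)) => x.
by case: (f x).
Qed.

Lemma FP_andb f g : FP f -> FP g -> FP (fun x => f x && g x).
Proof. by move=> hf hg; apply: FP_ext (FP_if hf hg (FP_const false)). Qed.

Lemma FP_orb f g : FP f -> FP g -> FP (fun x => f x || g x).
Proof. by move=> hf hg; apply: FP_ext (FP_if hf (FP_const true) hg). Qed.

Lemma FP_addb f g : FP f -> FP g -> FP (fun x => f x (+) g x).
Proof.
by move=> hf hg; apply: FP_ext (FP_if hf (FP_negb hg) hg) => x; case: (f x).
Qed.

Lemma FP_nilp A (cA : Code A) (l : X -> seq A) : FP l -> FP (fun x => nilp (l x)).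
Proof.
move=> hl.
have h : FP (fun _ : X * (A * seq A) => false) by exact: FP_const.
by apply: FP_ext (FP_case hl (FP_const true) h) => x; case: (l x).
Qed.

End Bool.

(** Proves [FP (fun x => e)] by the structure of [e]; [fp_more] and [fp_arith]
    are redefined as operations are added. *)
Ltac fp_more := fail.
Ltac fp1 := lazymatch goal with
  | |- FP (fun _ => ?c) => exact: FP_const
  | |- FP (fun x => x) => exact: FP_id
  | |- FP (fun x => (@?f x, @?g x)) => apply: (@FP_pair _ _ _ _ _ _ f g)
  | |- FP (fun x => fst (@?f x)) => apply: (@FP_fst_of _ _ _ _ _ _ f)
  | |- FP (fun x => snd (@?f x)) => apply: (@FP_snd_of _ _ _ _ _ _ f)
  | |- FP (fun x => @cons _ (@?f x) (@?g x)) => apply: (@FP_cons _ _ _ _ f g)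
  | |- FP (fun x => Some (@?f x)) => apply: (@FP_Some _ _ _ _ f)
  | |- FP (fun x => head (@?f x) (@?g x)) => apply: (@FP_head _ _ _ _ f g)
  | |- FP (fun x => behead (@?f x)) => apply: (@FP_behead _ _ _ _ f)
  | |- FP (fun x => nilp (@?f x)) => apply: (@FP_nilp _ _ _ _ f)
  | |- FP (fun x => oapp (@?g x) (@?d x) (@?o x)) =>
      apply: (@FP_oapp _ _ _ _ _ _ o g d)
  | |- FP (fun x => if _ then _ else _) => eapply FP_if
  | |- FP (fun x => ~~ @?f x) => apply: (@FP_negb _ _ f)
  | |- FP (fun x => @?f x && @?g x) => apply: (@FP_andb _ _ f g)
  | |- FP (fun x => @?f x || @?g x) => apply: (@FP_orb _ _ f g)
  | |- FP (fun x => @?f x (+) @?g x) => apply: (@FP_addb _ _ f g)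
  | _ => fp_more
  end; cbn beta.
Ltac fp_eta := lazymatch goal with
  | |- FP (fun x => _) => idtac
  | |- @FP ?A ?B ?cA ?cB ?f => change (@FP A B cA cB (fun x => f x))
  end.
Ltac fp := cbn beta; try fp_eta; first [assumption | fp1; fp | idtac].

Section Lists.
Context {X A B : Type} {cX : Code X} {cA : Code A} {cB : Code B}.

Lemma FP_catrev (l m : X -> seq A) : FP l -> FP m -> FP (fun x => catrev (l x) (m x)).
Proof.
move=> hl hm.
have E s t : foldl (fun t (a : A) => a :: t) t s = catrev s t by elim: s t => /=.
have h : FP (fun x => foldl (fun t (a : A) => a :: t) (m x) (l x)).
  apply: (FP_foldl (B := fun x => sz (l x) + sz (m x))) => //; first by fp.
    by apply: polyb_add; [case: hl | case: hm].
  move=> x k; rewrite E catrevE; have := @sz_cat _ cA (rev (take k (l x))) (m x).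
  by rewrite sz_rev; have := @sz_take _ cA (l x) k; lia.
by apply: FP_ext h => x; rewrite E.
Qed.

Lemma FP_rev (l : X -> seq A) : FP l -> FP (fun x => rev (l x)).
Proof. by move=> hl; exact: FP_catrev hl (FP_const [::]). Qed.

End Lists.

Lemma FP_cat X A (cX : Code X) (cA : Code A) (l m : X -> seq A) :
  FP l -> FP m -> FP (fun x => l x ++ m x).
Proof.
move=> hl hm; apply: FP_ext (FP_catrev (FP_rev hl) hm) => x.
by rewrite catrevE revK.
Qed.

Lemma FP_map X A B (cX : Code X) (cA : Code A) (cB : Code B)
    (l : X -> seq A) (f : X -> A -> B) :
  FP l -> FP (fun y : X * A => f y.1 y.2) -> FP (fun x => map (f x) (l x)).
Proof.
move=> hl hf.
have E x s t : foldl (fun t a => f x a :: t) t s = catrev (map (f x) s) t.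
  by elim: s t => /=.
have hf' : FP (fun y : X * (A * seq B) => f y.1 y.2.1).
  by apply: (FP_app2 (h := f)) => //; fp.
have h : FP (fun x => foldl (fun t (a : A) => f x a :: t) [::] (l x)).
  have [[P hP] _] := hf; have [sl _] := hl.
  apply: (FP_foldl (B := fun x => sz (l x) * (peval P (sz x + sz (l x) + 1)).+1 + 1)).
  - by [].
  - by fp.
  - by fp.
  - by polyb.
  move=> x k; rewrite E catrevE cats0 sz_rev.
  have lsz := @size_le_sz _ cA (take k (l x)); have tsz := @sz_take _ cA (l x) k.
  apply: leq_trans (_ : size (take k (l x)) * _ + 1 <= _).
    apply: (sz_map_le (M := peval P (sz x + sz (l x) + 1))) => i hi a0.
    have := @sz_nth_lt _ cA a0 _ _ hi; set a := nth _ _ _ => ha.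
    apply: leq_trans (hP (x, a)) (horner_le _ _); rewrite sz_pair /=; lia.
  rewrite leq_add2r leq_mul2r; lia.
apply: FP_ext (FP_rev h) => x; rewrite E catrevE cats0 revK //.
Qed.

Lemma FP_filter X A (cX : Code X) (cA : Code A)
    (l : X -> seq A) (p : X -> A -> bool) :
  FP l -> FP (fun y : X * A => p y.1 y.2) -> FP (fun x => filter (p x) (l x)).
Proof.
move=> hl hp.
have E x s t : foldl (fun t a => if p x a then a :: t else t) t s =
  catrev (filter (p x) s) t by elim: s t => //= a s IH t; rewrite IH; case: ifP.
have hp' : FP (fun y : X * (A * seq A) => p y.1 y.2.1).
  by apply: (FP_app2 (h := p)) => //; fp.
have h : FP (fun x => foldl (fun t a => if p x a then a :: t else t) [::] (l x)).
  have [sl _] := hl.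
  apply: (FP_foldl (B := fun x => sz (l x))); [by [] | by fp | by fp | by [] |].
  move=> x k; rewrite E catrevE cats0 sz_rev.
  exact: leq_trans (sz_filter _ _) (sz_take _ _).
by apply: FP_ext (FP_rev h) => x; rewrite E catrevE cats0 revK.
Qed.

Lemma FP_flatten X A (cX : Code X) (cA : Code A) (l : X -> seq (seq A)) :
  FP l -> FP (fun x => flatten (l x)).
Proof.
move=> hl.
have E (s : seq (seq A)) t : foldl (fun t a => catrev a t) t s = catrev (flatten s) t.
  by elim: s t => //= a s IH t; rewrite IH !catrevE rev_cat catA.
have szf (s : seq (seq A)) : sz (flatten s) <= sz s.
  elim: s => //= a s IH; have := @sz_cat _ cA a (flatten s); rewrite (sz_cons a); lia.
have h : FP (fun x => foldl (fun t a => catrev a t) [::] (l x)).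
  have [sl _] := hl.
  apply: (FP_foldl (B := fun x => sz (l x))) => //; first by fp.
    by apply: FP_catrev; fp.
  move=> x k; rewrite E catrevE cats0 sz_rev.
  exact: leq_trans (szf _) (sz_take _ _).
by apply: FP_ext (FP_rev h) => x; rewrite E catrevE cats0 revK.
Qed.

Lemma FP_has X A (cX : Code X) (cA : Code A)
    (l : X -> seq A) (p : X -> A -> bool) :
  FP l -> FP (fun y : X * A => p y.1 y.2) -> FP (fun x => has (p x) (l x)).
Proof.
move=> hl hp.
apply: FP_ext (FP_negb (FP_nilp (FP_filter hl hp))) => x.
by rewrite has_count -size_filter /nilp lt0n.
Qed.

Ltac fp_more ::= lazymatch goal with
  | |- FP (fun x => rev (@?f x)) => apply: (@FP_rev _ _ _ _ f)
  | |- FP (fun x => @?f x ++ @?g x) => apply: (@FP_cat _ _ _ _ f g)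
  | |- FP (fun x => map (@?f x) (@?l x)) => apply: (@FP_map _ _ _ _ _ _ l f)
  | |- FP (fun x => filter (@?f x) (@?l x)) => apply: (@FP_filter _ _ _ _ l f)
  | |- FP (fun x => flatten (@?f x)) => apply: (@FP_flatten _ _ _ _ f)
  | |- FP (fun x => has (@?f x) (@?l x)) => apply: (@FP_has _ _ _ _ l f)
  end.

(** * Natural numbers *)

Definition bval (s : seq bool) : nat := foldr (fun (b : bool) n => b + n.*2) 0 s.

(** Least significant digit first: the leading zeros are at the end. *)
Definition norm (s : seq bool) : seq bool :=
  foldr (fun (b : bool) s => if b || ~~ nilp s then b :: s else [::]) [::] s.

(** Numbers are coded in binary, without leading zeros, so that a number has
    one code. *)
#[export] Instance code_nat : Code nat := fun n => code (digits n).

Lemma digits_double (b : bool) n :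
  digits (b + n.*2) = if b || (n != 0) then b :: digits n else [::].
Proof.
have [n0|n0] := eqVneq n 0.
  by rewrite n0; case: b.
rewrite orbT /digits.
have -> : up_log 2 (b + n.*2).+1 = (up_log 2 n.+1).+1.
  by rewrite up_log2S ?half_bit_double //; lia.
rewrite /= expn0 divn1 oddD odd_double addbF; congr (_ :: _); first by case: b.
rewrite (iotaDl 1 0) -map_comp; apply: eq_map => k /=.
rewrite add1n expnS divnMA; congr (odd (_ %/ _)).
by rewrite -muln2 divnDMl ?modn_small //; case: b.
Qed.

Lemma bval_digits n : bval (digits n) = n.
Proof.
elim/ltn_ind: n => n IH; rewrite -[in LHS](odd_double_half n) digits_double.
case: ifP => h.
  rewrite /= IH ?odd_double_half //.
  by case: n h {IH} => [|[|n]] //= _; rewrite ltnS; lia.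
by rewrite -(odd_double_half n); case: (odd n) h => //= /negbFE/eqP->.
Qed.

Lemma digits_bval s : digits (bval s) = norm s.
Proof.
elim: s => // b s IH; rewrite [bval _]/= digits_double [RHS]/= -/(norm s) -IH.
case: b => //=; case e: (bval s) => [|n] //=.
have : digits n.+1 != [::]; last by case: (digits _).
by apply/eqP => h; have := bval_digits n.+1; rewrite h.
Qed.

Lemma bval_lt s : bval s < 2 ^ size s.
Proof. by elim: s => //= b s IH; rewrite expnS; case: b => /=; lia. Qed.

Lemma sz_bits (s : seq bool) : size s <= sz s <= 4 * size s + 1.
Proof.
elim: s => // b s /andP[h1 h2]; rewrite sz_cons /=.
have : sz b <= 3 by case: b.
lia.
Qed.

Lemma ltn_2sz (n : nat) : n < 2 ^ sz n.
Proof.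
rewrite -{1}(bval_digits n); apply: leq_trans (bval_lt _) _.
rewrite leq_exp2l //; exact: (proj1 (andP (sz_bits (digits n)))).
Qed.

Lemma sz_nat_lt (n k : nat) : n < 2 ^ k -> sz n <= 4 * k + 1.
Proof.
move=> lt_nk; apply: leq_trans (proj2 (andP (sz_bits (digits n)))) _.
rewrite leq_add2r leq_mul2l /= /digits size_map size_iota.
by have := leq_up_log 2 lt_nk; rewrite up_expnK.
Qed.

Lemma FP_digits : FP (fun n : nat => digits n). Proof. exact: FP_recode. Qed.

Lemma FP_bval : FP (fun s : seq bool => bval s).
Proof.
have h : FP (fun s : seq bool => foldl (fun s (b : bool) =>
     if b || ~~ nilp s then b :: s else [::]) [::] (rev s)).
  apply: (FP_foldl (B := fun s => 4 * sz s + 1)); [by fp | by fp | by fp | by polyb |].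
  move=> s k; apply: leq_trans (proj2 (andP (sz_bits _))) _.
  rewrite leq_add2r leq_mul2l /=.
  apply: leq_trans (_ : size (take k (rev s)) <= _); last first.
    rewrite -(sz_rev s); apply: leq_trans (sz_take (rev s) k).
    exact: (ltnW (size_le_sz _)).
  elim/last_ind: (take _ _) => [|t b IH] //; rewrite foldl_rcons size_rcons.
  by case: ifP.
apply: FP_code_eq h => s; rewrite -[RHS]/(code (digits (bval s))) digits_bval.
by congr code; rewrite foldl_rev.
Qed.

Section Ripple.
Variable f : bool -> bool -> bool -> bool * bool.

(** One pass over the digits serves for addition, subtraction and comparison:
    [f] returns a digit of the result and the next carry or borrow. *)
Fixpoint ripple (a b : seq bool) (c : bool) : seq bool * bool :=
  if a is d :: a' then
    let oc := f d (head false b) c in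
    let r := ripple a' (behead b) oc.2 in (oc.1 :: r.1, r.2)
  else ([::], c).

Definition ripple_step (s : seq bool * (bool * seq bool)) (d : bool) :=
  (behead s.1, ((f d (head false s.1) s.2.1).2,
                (f d (head false s.1) s.2.1).1 :: s.2.2)).

Lemma ripple_stepE a b c acc :
  (foldl ripple_step (b, (c, acc)) a).2 =
  ((ripple a b c).2, catrev (ripple a b c).1 acc).
Proof. by elim: a b c acc => //= d a IH b c acc; rewrite IH. Qed.

Hypothesis FPf : FP (fun p : bool * (bool * bool) => f p.1 p.2.1 p.2.2).

Lemma FP_ripple X (cX : Code X) (a b : X -> seq bool) :
  FP a -> FP b -> FP (fun x => ripple (a x) (b x) false).
Proof.
move=> ha hb.
have h : FP (fun x => foldl ripple_step (b x, (false, [::])) (a x)).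
  have [sa _] := ha; have [sb _] := hb.
  have hf : FP (fun y : X * (bool * (seq bool * (bool * seq bool))) =>
      f y.2.1 (head false y.2.2.1) y.2.2.2.1).
    apply: (FP_comp (f := fun p : bool * (bool * bool) => f p.1 p.2.1 p.2.2)
      (g := fun y : X * (bool * (seq bool * (bool * seq bool))) =>
             (y.2.1, (head false y.2.2.1, y.2.2.2.1)))) => //; by fp.
  apply: (FP_foldl (B := fun x => sz (b x) + 4 * sz (a x) + 10)) => //.
  - by fp.
  - rewrite /ripple_step; fp; exact: hf.
  - by polyb.
  move=> x k; set l := take k _; rewrite [foldl _ _ _]surjective_pairing.
  rewrite ripple_stepE !sz_pair /=.
  have h1 : sz (foldl ripple_step (b x, (false, [::])) l).1 <= sz (b x).
    elim/last_ind: l => // l d IH; rewrite foldl_rcons /= (leq_trans _ IH) //.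
    by case: (_.1) => //= e s; rewrite sz_cons; lia.
  have h2 : sz (ripple l (b x) false).2 <= 3 by case: (_.2).
  have h3 : sz (catrev (ripple l (b x) false).1 [::]) <= 4 * sz (a x) + 1.
    apply: leq_trans (proj2 (andP (sz_bits _))) _.
    rewrite catrevE cats0 size_rev leq_add2r leq_mul2l /=.
    apply: leq_trans (_ : size l <= _).
      by elim: l (b x) false {h1 h2} => //= d l IH b' c; exact: IH.
    by apply: leq_trans (ltnW (size_le_sz _)) (sz_take _ _).
  lia.
have h' : FP (fun x => (rev (foldl ripple_step (b x, (false, [::])) (a x)).2.2,
                        (foldl ripple_step (b x, (false, [::])) (a x)).2.1)).
  by fp.
apply: FP_ext h' => x; rewrite ripple_stepE /= catrevE cats0 revK.
by rewrite -surjective_pairing.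
Qed.

End Ripple.

Definition adder (d e c : bool) := (d (+) e (+) c, (d && (e || c)) || (e && c)).
Definition subber (d e c : bool) := (d (+) e (+) c, (~~ d && (e || c)) || (e && c)).

Lemma bval_cons b s : bval (b :: s) = b + (bval s).*2. Proof. by []. Qed.

Lemma ripple_add a b c : size b <= size a ->
  bval (ripple adder a b c).1 + (ripple adder a b c).2 * 2 ^ size a =
  bval a + bval b + c.
Proof.
elim: a b c => [|d a IH] [|e b] c //=; rewrite ?expn0 ?muln1 // => hs.
  by have := IH [::] (adder d false c).2 isT; rewrite expnS; case: d; case: c => /=; lia.
by have := IH b (adder d e c).2 hs; rewrite expnS; case: d; case: e; case: c => /=; lia.
Qed.

Lemma ripple_sub a b c : size b <= size a ->
  bval (ripple subber a b c).1 + bval b + c =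
  bval a + (ripple subber a b c).2 * 2 ^ size a.
Proof.
elim: a b c => [|d a IH] [|e b] c //=; rewrite ?expn0 ?muln1 // => hs.
  by have := IH [::] (subber d false c).2 isT; rewrite expnS; case: d; case: c => /=; lia.
by have := IH b (subber d e c).2 hs; rewrite expnS; case: d; case: e; case: c => /=; lia.
Qed.

(** [ripple] stops at the end of its first operand: the zeros make room for the
    second operand and for the last carry. *)
Definition pad (a b : seq bool) := a ++ false :: map (fun=> false) b.

Lemma bval_pad a b : bval (pad a b) = bval a.
Proof.
elim: a => [|d a IH] /=; last by rewrite -/(pad a b) IH.
by elim: b => //= _ b; case: (bval _).
Qed.

Lemma size_pad a b : size (pad a b) = (size a + size b).+1.
Proof. by rewrite size_cat /= size_map addnS. Qed.

Lemma size_ripple f a b c : size (ripple f a b c).1 = size a.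
Proof. by elim: a b c => //= d a IH b c; rewrite IH. Qed.

Lemma addn_ripple a b :
  bval (ripple adder (pad a b) b false).1 = bval a + bval b.
Proof.
have := @ripple_add (pad a b) b false; rewrite bval_pad size_pad => /(_ _)/wrap[].
  lia.
have lt : bval a + bval b < 2 ^ (size a + size b).+1.
  have : bval a < 2 ^ (size a + size b).
    by apply: leq_trans (bval_lt a) _; rewrite leq_exp2l // leq_addr.
  have : bval b < 2 ^ (size a + size b).
    by apply: leq_trans (bval_lt b) _; rewrite leq_exp2l // leq_addl.
  by rewrite expnS; lia.
by case: (_.2) => /=; lia.
Qed.

(** The last borrow tells whether the difference is negative. *)
Lemma subn_ripple a b : let r := ripple subber (pad a b) b false in
  r.2 = (bval a < bval b) /\ (bval b <= bval a -> bval r.1 = bval a - bval b).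
Proof.
set r := ripple _ _ _ _; move=> /=.
have := @ripple_sub (pad a b) b false; rewrite bval_pad size_pad -/r => /(_ _)/wrap[].
  lia.
have := bval_lt r.1; rewrite size_ripple size_pad.
by case: (r.2) => /=; lia.
Qed.

Section Arith.
Context {X : Type} {cX : Code X}.
Implicit Types f g : X -> nat.

Lemma FP_pad (a b : X -> seq bool) : FP a -> FP b -> FP (fun x => pad (a x) (b x)).
Proof. by move=> ha hb; rewrite /pad; fp. Qed.

Lemma FP_addn f g : FP f -> FP g -> FP (fun x => f x + g x).
Proof.
move=> hf hg; have da := FP_comp FP_digits hf; have db := FP_comp FP_digits hg.
have hA : FP (fun p : bool * (bool * bool) => adder p.1 p.2.1 p.2.2).
  by rewrite /adder; fp.
have h := FP_comp FP_bval (FP_fst_of (FP_ripple hA (FP_pad da db) db)).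
by apply: FP_ext h => x; rewrite addn_ripple !bval_digits.
Qed.

Lemma FP_sub_ripple f g : FP f -> FP g ->
  FP (fun x => ripple subber (pad (digits (f x)) (digits (g x))) (digits (g x)) false).
Proof.
move=> hf hg; have da := FP_comp FP_digits hf; have db := FP_comp FP_digits hg.
have hA : FP (fun p : bool * (bool * bool) => subber p.1 p.2.1 p.2.2).
  by rewrite /subber; fp.
have h := FP_ripple hA (FP_pad da db) db. exact: h.
Qed.

Lemma FP_leq f g : FP f -> FP g -> FP (fun x => f x <= g x).
Proof.
move=> hf hg; have h := FP_negb (FP_snd_of (FP_sub_ripple hg hf)).
apply: FP_ext h => x.
by have [-> _] := subn_ripple (digits (g x)) (digits (f x)); rewrite !bval_digits -leqNgt.
Qed.

Lemma FP_subn f g : FP f -> FP g -> FP (fun x => f x - g x).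
Proof.
move=> hf hg.
have h := FP_if (FP_leq hg hf)
  (FP_comp FP_bval (FP_fst_of (FP_sub_ripple hf hg))) (FP_const 0).
apply: FP_ext h => x; case: leqP => [le|/ltnW/eqP-> //].
have [_] := subn_ripple (digits (f x)) (digits (g x)); rewrite !bval_digits; exact.
Qed.

Lemma FP_eqn f g : FP f -> FP g -> FP (fun x => f x == g x).
Proof.
move=> hf hg; apply: FP_ext (FP_andb (FP_leq hf hg) (FP_leq hg hf)) => x.
by rewrite eqn_leq.
Qed.

End Arith.

(** Horner's scheme on the digits of the first factor. *)
Lemma FP_muln X (cX : Code X) (f g : X -> nat) : FP f -> FP g -> FP (fun x => f x * g x).
Proof.
move=> hf hg; have da := FP_comp FP_digits hf.
pose st b acc (d : bool) := acc + acc + (if d then b else 0).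
have E b l : foldl (st b) 0 l = bval (rev l) * b.
  elim/last_ind: l => // l d IH; rewrite foldl_rcons IH rev_rcons bval_cons.
  by rewrite /st; case: d; lia.
have h : FP (fun x => foldl (st (g x)) 0 (rev (digits (f x)))).
  have [sa _] := da; have [sg _] := hg.
  apply: (FP_foldl (B := fun x => 4 * (sz (digits (f x)) + sz (g x)) + 1)).
  - by fp.
  - by fp.
  - rewrite /st; apply: FP_addn; first by apply: FP_addn; fp.
    by apply: FP_if; fp; apply: (FP_comp hg); fp.
  - by polyb.
  move=> x k; rewrite E; apply: sz_nat_lt; rewrite expnD.
  apply: ltn_mul (ltn_2sz _); apply: leq_trans (bval_lt _) _.
  rewrite leq_exp2l // size_rev.
  apply: leq_trans (ltnW (size_le_sz _)) _.
  by apply: leq_trans (sz_take _ _) _; rewrite sz_rev.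
by apply: FP_ext h => x; rewrite E revK bval_digits.
Qed.

Lemma FP_succn X (cX : Code X) (f : X -> nat) : FP f -> FP (fun x => (f x).+1).
Proof.
by move=> hf; apply: FP_ext (FP_addn hf (FP_const 1)) => x; rewrite addn1.
Qed.

Section Indexing.
Context {X A : Type} {cX : Code X} {cA : Code A}.

Lemma FP_size (l : X -> seq A) : FP l -> FP (fun x => size (l x)).
Proof.
move=> hl; have [sl _] := hl.
have E s : foldl (fun n (_ : A) => n.+1) 0 s = size s.
  by elim/last_ind: s => // s a IH; rewrite foldl_rcons IH size_rcons.
have h : FP (fun x => foldl (fun n (_ : A) => n.+1) 0 (l x)).
  apply: (FP_foldl (B := fun x => 4 * sz (l x) + 1)); [by [] | by fp | | by polyb |].
    by apply: FP_succn; fp.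
  move=> x k; rewrite E; apply: sz_nat_lt.
  apply: leq_trans (ltn_expl _ (isT : 1 < 2)) _; rewrite leq_exp2l //.
  by apply: leq_trans (ltnW (size_le_sz _)) (sz_take _ _).
by apply: FP_ext h => x; rewrite E.
Qed.

(** A number bounded by the length of a list is small, even though its code is
    not a part of the list. *)
Lemma sz_size (l : seq A) n : n <= size l -> sz n <= 4 * sz l + 1.
Proof.
move=> le_n; apply: sz_nat_lt; apply: leq_trans (ltn_expl _ (isT : 1 < 2)) _.
by rewrite leq_exp2l // (leq_trans le_n) // ltnW // size_le_sz.
Qed.

(** The bound of an enumeration is given by a list, in unary: an enumeration up
    to a number in binary would be of exponential length. *)
Lemma FP_iota (l : X -> seq A) : FP l -> FP (fun x => iota 0 (size (l x))).
Proof.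
move=> hl; have [sl _] := hl.
pose st (s : nat * seq nat) (_ : A) := (s.1.+1, s.1 :: s.2).
have E s : foldl st (0, [::]) s = (size s, rev (iota 0 (size s))).
  elim/last_ind: s => // s a IH; rewrite foldl_rcons IH size_rcons /st.
  by rewrite -[(size s).+1]addn1 iotaD rev_cat.
have h : FP (fun x => rev (foldl st (0, [::]) (l x)).2).
  apply: FP_rev; apply: FP_snd_of.
  apply: (FP_foldl (B := fun x => (4 * sz (l x) + 1) +
    (sz (l x) * (4 * sz (l x) + 1).+1 + 1) + 1)).
  - by [].
  - by fp.
  - by rewrite /st; fp; apply: FP_succn; fp.
  - by polyb.
  move=> x k; rewrite E sz_pair /= sz_rev addn1 ltnS.
  have le_s : size (take k (l x)) <= size (l x) by rewrite size_take_min geq_minr.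
  apply: leq_add; first exact: sz_size.
  rewrite -[iota _ _]map_id.
  apply: leq_trans (_ : size (take k (l x)) * (4 * sz (l x) + 1).+1 + 1 <= _).
    apply: leq_trans (sz_map_le (M := 4 * sz (l x) + 1) _) _; last by rewrite size_iota.
    move=> i; rewrite size_iota => hi a0; rewrite nth_iota //.
    by apply: sz_size; apply: leq_trans (ltnW hi) _.
  rewrite leq_add2r leq_mul2r (leq_trans le_s) //; exact: (ltnW (size_le_sz _)).
by apply: FP_ext h => x; rewrite E revK.
Qed.

Lemma FP_nth (d : X -> A) (l : X -> seq A) (n : X -> nat) :
  FP d -> FP l -> FP n -> FP (fun x => nth (d x) (l x) (n x)).
Proof.
move=> hd hl hn.
pose st n (s : nat * A) (a : A) := (s.1.+1, if s.1 == n then a else s.2).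
have E n' d' s : foldl (st n') (0, d') s = (size s, nth d' s n').
  elim/last_ind: s => [|s a IH]; first by rewrite nth_nil.
  rewrite foldl_rcons IH size_rcons /st /= nth_rcons.
  by case: ltngtP => // lt; rewrite nth_default // ltnW.
have h : FP (fun x => (foldl (st (n x)) (0, d x) (l x)).2).
  have [sl _] := hl; have [sd _] := hd.
  apply: FP_snd_of.
  apply: (FP_foldl (B := fun x => (4 * sz (l x) + 1) + (sz (d x) + sz (l x)) + 1)).
  - by [].
  - by fp.
  - rewrite /st; fp; first by apply: FP_succn; fp.
    by apply: FP_eqn; fp; apply: (FP_comp hn); fp.
  - by polyb.
  move=> x k; rewrite E sz_pair /= addn1 ltnS.
  have le_s : size (take k (l x)) <= size (l x) by rewrite size_take_min geq_minr.
  apply: leq_add; first exact: sz_size.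
  case: (ltnP (n x) (size (take k (l x)))) => hn'; last first.
    by rewrite nth_default // leq_addr.
  apply: leq_trans (leq_addl _ _).
  by apply: leq_trans (ltnW (sz_nth_lt _ hn')) (sz_take _ _).
by apply: FP_ext h => x; rewrite E.
Qed.

End Indexing.

Lemma FP_mkseq X A B (cX : Code X) (cA : Code A) (cB : Code B)
    (l : X -> seq A) (f : X -> nat -> B) :
  FP l -> FP (fun y : X * nat => f y.1 y.2) ->
  FP (fun x => mkseq (f x) (size (l x))).
Proof. by move=> hl hf; rewrite /mkseq; apply: FP_map => //; apply: FP_iota. Qed.

Lemma sumn_lt_sz (l : seq nat) : sumn l < 2 ^ sz l.
Proof.
elim: l => // a l IH; rewrite sz_cons /= expnS expnD.
have := ltn_2sz a; move: IH; set u := 2 ^ _; set v := 2 ^ _; nia.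
Qed.

Lemma FP_sumn X (cX : Code X) (l : X -> seq nat) : FP l -> FP (fun x => sumn (l x)).
Proof.
move=> hl; have [sl _] := hl.
have E s : foldl addn 0 s = sumn s.
  by elim/last_ind: s => // s a IH; rewrite foldl_rcons IH sumn_rcons.
have h : FP (fun x => foldl addn 0 (l x)).
  apply: (FP_foldl (B := fun x => 4 * sz (l x) + 1)); [by [] | by fp | | by polyb |].
    by apply: FP_addn; fp.
  move=> x k; rewrite E; apply: sz_nat_lt; apply: leq_trans (sumn_lt_sz _) _.
  by rewrite leq_exp2l // sz_take.
by apply: FP_ext h => x; rewrite E.
Qed.

Ltac fp_arith := fail.
Ltac fp_hyp := match goal with
  | H : FP ?h |- FP (fun x => ?h (@?f x)) => apply: (@FP_comp _ _ _ _ _ _ h f H)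
  end.
Ltac fp_more ::= lazymatch goal with
  | |- FP (fun x => rev (@?f x)) => apply: (@FP_rev _ _ _ _ f)
  | |- FP (fun x => @?f x ++ @?g x) => apply: (@FP_cat _ _ _ _ f g)
  | |- FP (fun x => map (@?f x) (@?l x)) => apply: (@FP_map _ _ _ _ _ _ l f)
  | |- FP (fun x => filter (@?f x) (@?l x)) => apply: (@FP_filter _ _ _ _ l f)
  | |- FP (fun x => flatten (@?f x)) => apply: (@FP_flatten _ _ _ _ f)
  | |- FP (fun x => has (@?f x) (@?l x)) => apply: (@FP_has _ _ _ _ l f)
  | |- FP (fun x => S (@?f x)) => apply: (@FP_succn _ _ f)
  | |- FP (fun x => @?f x + @?g x) => apply: (@FP_addn _ _ f g)
  | |- FP (fun x => @?f x - @?g x) => apply: (@FP_subn _ _ f g)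
  | |- FP (fun x => @?f x * @?g x) => apply: (@FP_muln _ _ f g)
  | |- FP (fun x => @?f x <= @?g x) => apply: (@FP_leq _ _ f g)
  | |- FP (fun x => @eq_op Datatypes_nat__canonical__eqtype_Equality (@?f x) (@?g x)) =>
      apply: (@FP_eqn _ _ f g)
  | |- FP (fun x => nth (@?d x) (@?l x) (@?n x)) => apply: (@FP_nth _ _ _ _ d l n)
  | |- FP (fun x => iota 0 (size (@?l x))) => apply: (@FP_iota _ _ _ _ l)
  | |- FP (fun x => size (@?l x)) => apply: (@FP_size _ _ _ _ l)
  | |- FP (fun x => mkseq (@?f x) (size (@?l x))) =>
      apply: (@FP_mkseq _ _ _ _ _ _ l f)
  | |- FP (fun x => sumn (@?l x)) => apply: (@FP_sumn _ _ l)
  | |- _ => first [fp_hyp | fp_arith]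
  end.


(** * From programs on trees to machines on bit strings *)

Notation bits w := [seq (inl b : sym) | b <- w].

(** The input has no code of its own: its end is the end of the stack. *)
Definition read_word :=
  seqs (While R0 is_bit (mvbit R0 R1)) [:: Push R0 (inl false);
    While R1 is_bit (seqs
      (If R1 is1 (seqs (Push R0 (inl false)) [:: Push R0 (inl false); Push R0 (inl true)])
                 (Push R0 (inl false)))
      [:: Push R0 (inl true); Pop R1])].

Definition write_word :=
  seqs (While R0 is1 (Seq (Pop R0)
          (If R0 is1 (seqs (Pop R0) [:: Pop R0; Pop R0; Push R1 (inl true)])
                     (Seq (Pop R0) (Push R1 (inl false))))))
       [:: Pop R0; While R1 is_bit (mvbit R1 R0)].

Lemma run_mv_all r r' w s : r <> r' -> get s r = bits w ->
  run (While r is_bit (mvbit r r')) s (10 * size w + 1)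
      (upd (upd s r [::]) r' (rev (bits w) ++ get s r')).
Proof.
move=> ne e; apply: (@run_le _ _ (8 * size w + 1)); first lia.
rewrite -(size_map (fun b => inl b : sym) w).
apply: run_mvbits => //; first by rewrite cats0.
by rewrite all_map; apply/allP.
Qed.

Lemma run_read_word w :
  run read_word (bits w, [::], [::]) (100 * size w + 100) (enc (code w), [::], [::]).
Proof.
apply: run_le (_ : (10 * size w + 1) + (2 + (20 * size w + 1)) <= _) _; first lia.
apply: run_seq; first exact: (@run_mv_all R0 R1 w).
apply: run_seq; first exact: run_push.
have E : enc (code w) = enc (code (catrev (rev w) [::])).
  by rewrite catrevE revK cats0.
rewrite /= cats0 E -map_rev -(size_rev w).
have E0 : [:: inl false] = enc (code ([::] : seq bool)) by [].
rewrite E0.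
elim: (rev w) [::] {E E0} => [|b v IH] s; first exact: run_whileF.
apply: run_le (_ : (13 + (20 * size v + 1)).+2 <= _) _; first by rewrite /=; lia.
apply: run_whileT (IH _) => //; case: b.
  by apply: run_le (_ : (2 + (2 + 2)).+2 + (2 + 1) <= _) _ => //; step.
by apply: run_le (_ : 2.+2 + (2 + 1) <= _) _ => //; step.
Qed.

Lemma run_write_word w :
  run write_word (enc (code w), [::], [::]) (100 * size w + 100) (bits w, [::], [::]).
Proof.
apply: run_le (_ : (20 * size w + 1) + (1 + (10 * size w + 1)) <= _) _; first lia.
apply: (@run_seq _ _ _ ([:: inl false], rev (bits w), [::])); last first.
  apply: run_seq; first exact: run_pop.
  have := @run_mv_all R1 R0 (rev w) ([::], rev (bits w), [::]).
  by rewrite size_rev !map_rev revK /= cats0; apply.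
have gen s : run (While R0 is1 (Seq (Pop R0)
          (If R0 is1 (seqs (Pop R0) [:: Pop R0; Pop R0; Push R1 (inl true)])
                     (Seq (Pop R0) (Push R1 (inl false))))))
    (enc (code w), s, [::]) (20 * size w + 1)
    ([:: inl false], rev (bits w) ++ s, [::]).
  elim: w s => [|b w IH] s; first exact: run_whileF.
  apply: run_le (_ : (10 + (20 * size w + 1)).+2 <= _) _; first by rewrite /=; lia.
  rewrite map_cons rev_cons cat_rcons.
  apply: (@run_whileT _ _ _ _ (enc (code w), inl b :: s, [::])) => //; case: b.
    by apply: run_le (_ : 1 + (1 + (1 + (1 + 2))).+2 <= _) _ => //; step.
  by apply: run_le (_ : 1 + (1 + 2).+2 <= _) _ => //; step.
by have := gen [::]; rewrite cats0.
Qed.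

Theorem FP_machine (f : seq bool -> seq bool) : FP f ->
  exists (M : tm) (p : {poly nat}), forall w,
    let c := iter (peval p (size w)) (@tm_step M) (tm_init M w) in
    tm_halt (cf_state c) /\ tm_output c = f w.
Proof.
case=> [[S hS] [p [F [P hP] hp]]].
have lin a b : {L : {poly nat} | forall n, peval L n = a * n + b}.
  exists (a%:P * 'X + b%:P)%R => n.
  by rewrite /peval hornerD hornerM hornerX !hornerC.
have [[Q QE] [C CE]] := (lin 4 1, lin 100 100).
exists (machine (compile 0 (Seq read_word (Seq p write_word)))).
exists (C + ((P \Po Q) + (C \Po (S \Po Q))))%R => w.
have le_sz : sz w <= peval Q (size w) by rewrite QE; case/andP: (sz_bits w).
have hr : run (Seq read_word (Seq p write_word)) (bits w, [::], [::])
    ((100 * size w + 100) + (F w + (100 * size (f w) + 100)))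
    (bits (f w), [::], [::]).
  apply: run_seq; first exact: run_read_word.
  apply: run_seq; last exact: run_write_word.
  by have := hp w [::] [::] [::]; rewrite !cats0.
have [n le_n en] := hr; apply: exec_machine en _; apply: leq_trans le_n _.
rewrite [peval _ _]hornerD hornerD !horner_comp -!/(peval _ _) !CE.
apply: leq_add => //; apply: leq_add.
  exact: leq_trans (hP w) (horner_le _ le_sz).
rewrite leq_add2r; apply: leq_mul => //.
apply: leq_trans (horner_le S le_sz).
apply: leq_trans (hS w); exact: (proj1 (andP (sz_bits _))).
Qed.

(** * The assignment problem *)

Section Assignment.
Variables (T C : nat) (w : nat -> nat -> nat).

Definition setmatch (m : nat -> option nat) c t : nat -> option nat :=
  fun c' => if c' == c then Some t else m c'.

(** Complementary slackness for a matching [m] of the rows up to [s], except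
    [t], while a search has reached the rows [S] and the columns [K].  Since [m]
    matches reached rows with reached columns, a change of potentials along the
    search leaves its edges tight. *)
Record good_match (U V : nat -> nat) (s : nat) (S K : seq nat) (t : nat)
    (m : nat -> option nat) : Prop := GoodMatch {
  match_tight c r : m c = Some r -> [/\ c < C, r <= s, r != t & w r c = U r + V c];
  match_inj c c' r : m c = Some r -> m c' = Some r -> c = c';
  match_free c : m c = None -> V c = 0;
  match_row r : r <= s -> r != t -> U r = 0 \/ exists c, m c = Some r;
  match_tree c r : m c = Some r -> (r \in S) = (c \in K);
  match_reached c : c \in K -> m c != None
}.

Definition lower (U : nat -> nat) (S : seq nat) d r := if r \in S then U r - d else U r.
Definition raise (V : nat -> nat) (K : seq nat) d c := if c \in K then V c + d else V c.

Lemma good_reprice U V s S K t m d :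
  good_match U V s S K t m -> (forall r, r \in S -> d <= U r) ->
  good_match (lower U S d) (raise V K d) s S K t m.
Proof.
case=> h1 h2 h3 h4 h5 h6 hd; split=> //.
- move=> c r e; have [lt_c le_r ne ->] := h1 c r e; split=> //.
  rewrite /lower /raise -(h5 c r e); case: ifP => // hr.
  by have := hd r hr; lia.
- move=> c e; rewrite /raise; case: ifP => [/h6|_]; last exact: h3.
  by rewrite e.
- move=> r le_r ne; case: (h4 r le_r ne) => [e|]; [left | by right].
  by rewrite /lower e; case: ifP.
Qed.

(** A row of potential 0 may stay unmatched: the search ends at such a row. *)
Lemma good_skip U V s S K t m : good_match U V s S K t m -> U t = 0 ->
  good_match U V s.+1 [:: s.+1] [::] s.+1 m.
Proof.
case=> h1 h2 h3 h4 h5 h6 u0; split=> //.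
- move=> c r /h1[lt_c le_r ne tight]; split=> //; first exact: leqW.
  by rewrite neq_ltn ltnS le_r.
- move=> r le_r ne; have {}le_r : r <= s by rewrite -ltnS ltn_neqAle ne.
  by have [->|] := eqVneq r t; [left | exact: h4].
- move=> c r /h1[_ le_r _ _]; rewrite inE in_nil; apply/negbTE.
  by rewrite neq_ltn ltnS le_r.
Qed.

(** A column without owner, joined to [t] by a tight edge, ends the search. *)
Lemma good_augment U V s S K t m c : good_match U V s S K t m -> t <= s ->
  c < C -> m c = None -> w t c = U t + V c ->
  good_match U V s.+1 [:: s.+1] [::] s.+1 (setmatch m c t).
Proof.
case=> h1 h2 h3 h4 h5 h6 le_t lt_c e tight; rewrite /setmatch; split=> //.
- move=> c' r; case: eqP => [-> [<-]|_ /h1[lt_c' le_r ne ->]].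
    by split; rewrite ?leqW // neq_ltn ltnS le_t.
  by split; rewrite ?leqW // neq_ltn ltnS le_r.
- move=> c' c'' r; case: eqP => [->|_] e1; case: eqP => [->|_] e2 //.
  + by have [_ _ /eqP[]] := h1 _ _ e2; case: e1.
  + by have [_ _ /eqP[]] := h1 _ _ e1; case: e2.
  + exact: h2 e1 e2.
- by move=> c'; case: eqP => // _; exact: h3.
- move=> r le_r ne; have {}le_r : r <= s by rewrite -ltnS ltn_neqAle ne.
  have [->|nt] := eqVneq r t; first by right; exists c; rewrite eqxx.
  case: (h4 r le_r nt) => [|[c' e']]; [by left | right].
  by exists c'; case: eqP e' => // ->; rewrite e.
- move=> c' r; rewrite inE in_nil => e'; apply/negbTE.
  suff le_r : r <= s by rewrite neq_ltn ltnS le_r.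
  by case: eqP e' => [_ [<-] //|_ /h1[]].
Qed.

(** The column that is reached has an owner [r], which is freed for [t]: this
    is the matching that is kept for [r]. *)
Lemma good_switch U V s S K t m c r : good_match U V s S K t m -> t <= s ->
  t \in S -> c \notin K -> m c = Some r -> w t c = U t + V c ->
  good_match U V s (r :: S) (c :: K) r (setmatch m c t).
Proof.
case=> h1 h2 h3 h4 h5 h6 le_t St Kc e tight; rewrite /setmatch.
have [lt_c le_r ne _] := h1 _ _ e; split=> //.
- move=> c' r'; case: eqP => [-> [<-]|nc e'].
    by split=> //; rewrite eq_sym.
  have [-> -> _ ->] := h1 _ _ e'; split=> //.
  by apply/eqP => er; apply: nc; apply: h2 e' _; rewrite er.
- move=> c' c'' r'; case: eqP => [->|_] e1; case: eqP => [->|_] e2 //.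
  + by have [_ _ /eqP[]] := h1 _ _ e2; case: e1.
  + by have [_ _ /eqP[]] := h1 _ _ e1; case: e2.
  + exact: h2 e1 e2.
- by move=> c'; case: eqP => // _; exact: h3.
- move=> r' le_r' ne'; have [->|nt] := eqVneq r' t.
    by right; exists c; rewrite eqxx.
  case: (h4 r' le_r' nt) => [|[c' e']]; [by left | right].
  by exists c'; case: eqP e' => // ->; rewrite e => -[/eqP]; rewrite eq_sym (negPf ne').
- move=> c' r'; rewrite !inE; case: eqP => [-> [<-]|nc e'] /=.
    by rewrite St orbT.
  rewrite (h5 _ _ e'); case: eqP => // er; case: nc; apply: h2 e' _.
  by rewrite er.
- by move=> c'; rewrite inE; case: eqP => //= _; exact: h6.
Qed.

(** The other matchings of the tree agree with [m] outside of [K], so that they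
    give [c] to [r] too. *)
Lemma good_extend U V s S K t m c r : good_match U V s S K t m ->
  c \notin K -> m c = Some r -> good_match U V s (r :: S) (c :: K) t m.
Proof.
case=> h1 h2 h3 h4 h5 h6 Kc e; split=> //.
  move=> c' r' e'; rewrite !inE; have [ec|nc] := eqVneq c' c.
    by move: e'; rewrite ec e => -[->]; rewrite eqxx.
  rewrite (h5 _ _ e') /=; case: eqP => // er; case/eqP: nc.
  by apply: h2 e' _; rewrite er.
by move=> c'; rewrite inE; case: eqP => [->|_ /h6 //]; rewrite e.
Qed.

(** Weak duality: potentials that cover all the weights bound the weight of any
    matching by their sum, and [m] reaches this bound, since its edges are tight
    and the unmatched rows and columns have potential 0. *)
Lemma good_optimal U V S K m m' :
  (forall t c, t < T -> c < C -> w t c <= U t + V c) ->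
  good_match U V T S K T m ->
  (forall c t, c < C -> m' c = Some t -> t < T) ->
  (forall c c' t, c < C -> c' < C -> m' c = Some t -> m' c' = Some t -> c = c') ->
  \sum_(c < C) oapp (w^~ c) 0 (m' c) <= \sum_(c < C) oapp (w^~ c) 0 (m c).
Proof.
move=> cover [h1 h2 h3 h4 _ _] lt_m' inj_m'.
have lt_m c t : m c = Some t -> t < T by case/h1=> _ le_t ne _; rewrite ltn_neqAle ne.
have sumE (n : nat -> option nat) : (forall c t, c < C -> n c = Some t -> t < T) ->
    \sum_(c < C) oapp U 0 (n c) =
    \sum_(t < T) U t * \sum_(c < C) (n c == Some (t : nat)).
  move=> lt_n; under [RHS]eq_bigr do rewrite big_distrr /=.
  rewrite exchange_big /=; apply: eq_bigr => c _.
  case e: (n c) => [t|] /=; last by rewrite big1 // => t _; rewrite muln0.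
  rewrite (bigD1 (Ordinal (lt_n _ _ (ltn_ord c) e))) //= eqxx muln1 big1 ?addn0 //.
  move=> t' ne; case: eqP => [[et]|]; rewrite ?muln0 //.
  by case/eqP: ne; apply: val_inj.
apply: leq_trans (_ : \sum_(c < C) (oapp U 0 (m' c) + V c) <= _).
  apply: leq_sum => c _; case e: (m' c) => [t|] //=.
  by apply: cover => //; apply: lt_m' e.
have -> : \sum_(c < C) oapp (w^~ c) 0 (m c) = \sum_(c < C) (oapp U 0 (m c) + V c).
  apply: eq_bigr => c _; case e: (m c) => [t|] /=; last by rewrite h3.
  by case: (h1 _ _ e).
rewrite !big_split /= leq_add2r (sumE m') // (sumE m) => [|c t _]; last exact: lt_m.
apply: leq_sum => t _.
have ne : (t : nat) != T by rewrite neq_ltn ltn_ord.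
have [->//|[c e]] := h4 t (ltnW (ltn_ord t)) ne.
have [lt_c _ _ _] := h1 _ _ e; rewrite leq_mul2l; apply/orP; right.
apply: (@leq_trans 1); last first.
  by rewrite (bigD1 (Ordinal lt_c)) //= e eqxx leq_addr.
have [c' /eqP e'|none] := pickP (fun c : 'I_C => m' c == Some (t : nat)); last first.
  by rewrite big1 // => c' _; rewrite none.
rewrite (bigD1 c') //= e' eqxx big1 // => c'' ne'; case: eqP => // e''.
by case/eqP: ne'; apply: val_inj; apply: inj_m' e'' e'.
Qed.

End Assignment.

(** Maps the columns to their owners. *)
Definition matching := seq (option nat).

(** The Hungarian method: the rows are inserted one by one.  A state
    [(u, v, (s, (K, tree)))] consists of the potentials of the rows and of the
    columns, the row [s] that is being inserted, the columns [K] that the search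
    has reached, and, for every row that it has reached, a matching of the
    other rows up to [s].  These matchings replace the parent pointers of the
    search, and augmenting paths never appear. *)
Definition hstate :=
  ((seq nat * seq nat) * (nat * (seq nat * seq (nat * matching))))%type.

(** A slack, a column or [None] for the decision to leave the row unmatched,
    and the branch of the tree that it extends. *)
Definition candidate := (nat * (option nat * (nat * matching)))%type.

Section Hungarian.
Variables (W : seq (seq nat)) (rT rI : seq bool).

Definition wt (t c : nat) : nat := nth 0 (nth [::] W t) c.
Definition memn (s : seq nat) (x : nat) : bool := has (fun y => y == x) s.

Definition candidates (st : hstate) : seq candidate :=
  flatten [seq (nth 0 st.1.1 e.1, (None, e)) ::
    [seq (nth 0 st.1.1 e.1 + nth 0 st.1.2 c - wt e.1 c, (Some c, e))
       | c <- filter (fun c => ~~ memn st.2.2.1 c) (iota 0 (size rI))]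
    | e <- st.2.2.2].

(* Default value: the tree, and hence the list of candidates, is nonempty in all
   the states that are reached. *)
Definition cand0 : candidate := (0, (None, (0, [::]))).

Definition best (l : seq candidate) : candidate :=
  foldl (fun b x => if x.1 <= b.1 then x else b) (head cand0 l) l.

Definition new_u (st : hstate) d : seq nat :=
  mkseq (fun t => if memn (map fst st.2.2.2) t then nth 0 st.1.1 t - d
                  else nth 0 st.1.1 t) (size rT).

Definition new_v (st : hstate) d : seq nat :=
  mkseq (fun c => if memn st.2.2.1 c then nth 0 st.1.2 c + d
                  else nth 0 st.1.2 c) (size rI).

Definition new_match (m : matching) c t : matching :=
  mkseq (fun c' => if c' == c then Some t else nth None m c') (size rI).

Definition restart (s : nat) (m : matching) : nat * (seq nat * seq (nat * matching)) :=
  (s.+1, ([::], [:: (s.+1, m)])).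

Definition reach (st : hstate) (e : nat * matching) (c : nat) :=
  oapp (fun r => (st.2.1, (c :: st.2.2.1, (r, new_match e.2 c e.1) :: st.2.2.2)))
       (restart st.2.1 (new_match e.2 c e.1)) (nth None e.2 c).

Definition tick_with (st : hstate) (b : candidate) : hstate :=
  ((new_u st b.1, new_v st b.1),
   oapp (reach st b.2.2) (restart st.2.1 b.2.2.2) b.2.1).

Definition tick (st : hstate) : hstate :=
  if size rT <= st.2.1 then st else tick_with st (best (candidates st)).

(** The sum of a row covers its weights without the help of the columns. *)
Definition hinit : hstate :=
  ((mkseq (fun t => sumn (nth [::] W t)) (size rT), mkseq (fun=> 0) (size rI)),
   (0, ([::], [:: (0, mkseq (fun=> None) (size rI))]))).

(** A list of length [T * T], since a fold takes its number of steps from a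
    list. *)
Definition fuel : seq bool := flatten (map (fun=> rT) rT).

Definition hrun : hstate := foldl (fun st _ => tick st) hinit fuel.

Definition hungarian : matching := (head (0, [::]) hrun.2.2.2).2.

Lemma memnE s x : memn s x = (x \in s).
Proof. by rewrite /memn -has_pred1. Qed.

Notation T := (size rT).
Notation C := (size rI).

Lemma nth_mkseq_ext A (d : A) f n i :
  (forall j, n <= j -> f j = d) -> nth d (mkseq f n) i = f i.
Proof.
move=> h; case: (ltnP i n) => hi; first exact: nth_mkseq.
by rewrite nth_default ?size_mkseq // h.
Qed.

Record hinv (st : hstate) : Prop := HInv {
  inv_su : size st.1.1 = T;
  inv_sv : size st.1.2 = C;
  inv_cover t c : t < T -> c < C -> wt t c <= nth 0 st.1.1 t + nth 0 st.1.2 c;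
  inv_s : st.2.1 <= T;
  inv_K c : c \in st.2.2.1 -> c < C;
  inv_S : uniq (map fst st.2.2.2) && all (fun r => r <= st.2.1) (map fst st.2.2.2);
  inv_good e : e \in st.2.2.2 ->
    good_match C wt (nth 0 st.1.1) (nth 0 st.1.2) st.2.1 (map fst st.2.2.2)
      st.2.2.1 e.1 (nth None e.2);
  inv_agree e e' c : e \in st.2.2.2 -> e' \in st.2.2.2 -> c \notin st.2.2.1 ->
    nth None e.2 c = nth None e'.2 c;
  inv_tree : st.2.2.2 != [::];
  inv_end : st.2.1 = T -> map fst st.2.2.2 = [:: T]
}.

Lemma bestP l : l != [::] ->
  best l \in l /\ forall x, x \in l -> (best l).1 <= x.1.
Proof.
case: l => // x0 l _; rewrite /best [head _ _]/=.
set f := fun b x : candidate => _; set l0 := x0 :: l.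
suff gen l1 b : b \in l0 -> {subset l1 <= l0} ->
    [/\ foldl f b l1 \in l0, (foldl f b l1).1 <= b.1 &
        forall x, x \in l1 -> (foldl f b l1).1 <= x.1].
  by have [||h1 _ h2] := gen l0 x0; rewrite ?mem_head.
elim: l1 b => [|x l1 IH] b hb sub //=.
have hx : x \in l0 by apply: sub; rewrite mem_head.
have hf : f b x \in l0 by rewrite /f; case: ifP.
have [|h1 h2 h3] := IH (f b x) hf.
  by move=> y hy; apply: sub; rewrite inE hy orbT.
have hfb : (f b x).1 <= b.1 by rewrite /f; case: ifP.
have hfx : (f b x).1 <= x.1 by rewrite /f; case: (leqP x.1 b.1) => // /ltnW.
split=> //; first exact: leq_trans hfb.
by move=> y; rewrite inE => /orP[/eqP->|/h3 //]; exact: leq_trans hfx.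
Qed.

Lemma candidatesP st x : reflect
  (exists2 e, e \in st.2.2.2 &
     x = (nth 0 st.1.1 e.1, (None, e)) \/
     exists c, [/\ c < C, c \notin st.2.2.1 &
       x = (nth 0 st.1.1 e.1 + nth 0 st.1.2 c - wt e.1 c, (Some c, e))])
  (x \in candidates st).
Proof.
apply: (iffP idP) => [/flatten_mapP[e he]|[e he h]].
  rewrite inE => /orP[/eqP->|/mapP[c]]; first by exists e => //; left.
  rewrite mem_filter memnE mem_iota /= add0n => /andP[Kc lt_c] ->.
  by exists e => //; right; exists c.
apply/flatten_mapP; exists e => //; rewrite inE.
case: h => [->|[c [lt_c Kc ->]]]; first by rewrite eqxx.
apply/orP; right; apply: map_f.
by rewrite mem_filter memnE Kc mem_iota.
Qed.

Lemma nth_new_u st d : size st.1.1 = T ->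
  nth 0 (new_u st d) =1 lower (nth 0 st.1.1) (map fst st.2.2.2) d.
Proof.
move=> hs t; rewrite nth_mkseq_ext; first by rewrite memnE.
by move=> j hj; rewrite nth_default ?hs //; case: ifP.
Qed.

Lemma nth_new_v st d : size st.1.2 = C -> (forall c, c \in st.2.2.1 -> c < C) ->
  nth 0 (new_v st d) =1 raise (nth 0 st.1.2) st.2.2.1 d.
Proof.
move=> hs hK c; rewrite nth_mkseq_ext; first by rewrite memnE.
move=> j hj; rewrite nth_default ?hs // memnE; case: ifP => // /hK.
by rewrite ltnNge hj.
Qed.

Lemma nth_new_match U V s S K t m c : good_match C wt U V s S K t (nth None m) ->
  c < C -> nth None (new_match m c t) =1 setmatch (nth None m) c t.
Proof.
move=> g lt_c c'; rewrite nth_mkseq_ext // => j hj.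
case: eqP => [ej|_]; first by rewrite ej leqNgt lt_c in hj.
case e: (nth None m j) => [r|] //; have [] := match_tight g e.
by rewrite ltnNge hj.
Qed.

Lemma good_match_eq U U' V V' s S K t m m' : U =1 U' -> V =1 V' -> m =1 m' ->
  good_match C wt U V s S K t m -> good_match C wt U' V' s S K t m'.
Proof.
move=> eU eV em [h1 h2 h3 h4 h5 h6]; split.
- by move=> c r; rewrite -em -eU -eV; exact: h1.
- by move=> c c' r; rewrite -!em; exact: h2.
- by move=> c; rewrite -em -eV; exact: h3.
- move=> r le_r ne; have [|[c e]] := h4 r le_r ne; first by rewrite -eU; left.
  by right; exists c; rewrite -em.
- by move=> c r; rewrite -em; exact: h5.
- by move=> c; rewrite -em; exact: h6.
Qed.

(** A search reaches at most [s.+1] rows, so that a completed search, which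
    increases [s], makes more progress than its restart loses. *)
Definition progress (st : hstate) : nat := st.2.1 * T + (size st.2.2.2).-1.

Lemma tick_inv st : hinv st -> st.2.1 < T ->
  hinv (tick st) /\ progress st < progress (tick st).
Proof.
move=> [su sv cover _ hK /andP[uS aS] good agree hne _] lt_s.
rewrite /tick leqNgt lt_s /=.
have cne : candidates st != [::].
  have [e0 he0] : exists e0, e0 \in st.2.2.2.
    by case: st.2.2.2 hne => // e0 tr _; exists e0; rewrite mem_head.
  apply/eqP => E; suff : (nth 0 st.1.1 e0.1, (None, e0)) \in candidates st by rewrite E.
  by apply/candidatesP; exists e0 => //; left.
have [hb hmin] := bestP cne.
have := hb; set b := best _ in hb hmin *.
case/candidatesP => e he hbE.
set U := nth 0 st.1.1 in cover good *; set V := nth 0 st.1.2 in cover good *.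
set S := map fst st.2.2.2 in uS aS good *; set K := st.2.2.1 in hK good agree *.
have Se : e.1 \in S by exact: map_f.
have le_e : e.1 <= st.2.1 by exact: (allP aS).
have lt_e : e.1 < T by apply: leq_ltn_trans lt_s.
have dU r : r \in S -> b.1 <= U r.
  case/mapP => e' he' ->.
  by apply: (hmin (U e'.1, (None, e'))); apply/candidatesP; exists e' => //; left.
have dV r c : r \in S -> c < C -> c \notin K -> b.1 <= U r + V c - wt r c.
  case/mapP => e' he' -> lt_c Kc.
  apply: (hmin (U e'.1 + V c - wt e'.1 c, (Some c, e'))).
  by apply/candidatesP; exists e' => //; right; exists c.
have eU := nth_new_u b.1 su; have eV := nth_new_v b.1 sv hK.
have cover' t c : t < T -> c < C ->
    wt t c <= nth 0 (new_u st b.1) t + nth 0 (new_v st b.1) c.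
  move=> lt_t lt_c; rewrite eU eV /lower /raise -/S -/K.
  have := cover t c lt_t lt_c; have := dU t; have := dV t c.
  case: (t \in S); case: (boolP (c \in K)) => // _ h1 h2; rewrite -/U -/V; last lia.
  - by have := h2 isT; lia.
  - by have := h2 isT; have := h1 isT lt_c isT; lia.
have good' e' : e' \in st.2.2.2 ->
    good_match C wt (nth 0 (new_u st b.1)) (nth 0 (new_v st b.1)) st.2.1 S K e'.1
      (nth None e'.2).
  by move=> he'; apply: good_match_eq (good_reprice (good e' he') dU).
have restart_inv m :
    good_match C wt (nth 0 (new_u st b.1)) (nth 0 (new_v st b.1)) st.2.1.+1
      [:: st.2.1.+1] [::] st.2.1.+1 (nth None m) ->
    hinv ((new_u st b.1, new_v st b.1), restart st.2.1 m) /\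
    progress st < progress ((new_u st b.1, new_v st b.1), restart st.2.1 m).
  move=> gm; split; last first.
    rewrite /progress /= addn0 mulSn addnC ltn_add2r.
    have : size S <= st.2.1.+1.
      rewrite -[X in _ <= X](size_iota 0); apply: uniq_leq_size => // r /(allP aS).
      by rewrite mem_iota add0n ltnS.
    by rewrite size_map; case: (size _) => // n; lia.
  split=> //=; rewrite ?size_mkseq ?leqnn //.
  - by move=> e'; rewrite inE => /eqP->.
  - by move=> e' e'' c; rewrite !inE => /eqP-> /eqP->.
  - by move=> ->.
(* The change of potentials makes the selected edge tight. *)
have tight c : c < C -> c \notin K -> b.1 = U e.1 + V c - wt e.1 c ->
    wt e.1 c = nth 0 (new_u st b.1) e.1 + nth 0 (new_v st b.1) c.
  move=> lt_c Kc eb; rewrite eU eV /lower /raise -/S -/K Se (negPf Kc) -/U -/V.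
  by have := cover _ _ lt_e lt_c; have := dU _ Se; lia.
rewrite /tick_with; case: hbE => [eb|[c [lt_c Kc eb]]].
  have -> : b.2 = (None, e) by rewrite eb.
  apply: restart_inv; apply: good_skip (good' e he) _.
  by rewrite eU /lower -/S Se -/U eb subnn.
have eb1 : b.1 = U e.1 + V c - wt e.1 c by rewrite eb.
have tc := tight c lt_c Kc eb1; have ge := good' e he.
have -> : b.2 = (Some c, e) by rewrite eb.
rewrite /reach /=; case em: (nth None e.2 c) => [r|] /=; last first.
  apply: restart_inv; apply: good_match_eq (good_augment ge _ lt_c em tc) => //.
  by move=> c'; rewrite (nth_new_match ge).
have Sr : r \notin S by rewrite (match_tree ge em).
have [_ le_r _ _] := match_tight ge em.
split; last by rewrite /progress /= ltn_add2l prednK // lt0n size_eq0.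
split=> //=; rewrite ?size_mkseq //.
- exact: ltnW.
- by move=> c'; rewrite inE => /orP[/eqP->|/hK].
- by rewrite Sr uS le_r.
- move=> e'; rewrite inE => /orP[/eqP->|he'] /=.
    apply: good_match_eq (good_switch ge le_e Se Kc em tc) => // c'.
    by rewrite (nth_new_match ge).
  have em' : nth None e'.2 c = Some r by rewrite (agree _ _ _ he' he Kc).
  exact: good_extend (good' e' he') Kc em'.
- have agr e' c' : e' \in (r, new_match e.2 c e.1) :: st.2.2.2 ->
      c' \notin c :: K -> nth None e'.2 c' = nth None e.2 c'.
    rewrite !inE negb_or => /orP[/eqP->|he'] /andP[nc Kc'] /=; last exact: agree.
    by rewrite (nth_new_match ge) // /setmatch (negPf nc).
  by move=> e' e'' c' he' he'' hc'; rewrite !agr.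
- by move=> es; rewrite es ltnn in lt_s.
Qed.

Lemma hinit_inv : hinv hinit.
Proof.
have zero : nth 0 (mkseq (fun=> 0) C) =1 fun=> 0.
  by move=> c; rewrite nth_mkseq_ext.
have none : nth None (mkseq (fun=> None) C) =1 fun=> None :> option nat.
  by move=> c; rewrite nth_mkseq_ext.
split=> //=; rewrite ?size_mkseq //.
- move=> t c lt_t lt_c; rewrite nth_mkseq // zero addn0 /wt.
  move: (nth [::] W t) c {lt_c} => r.
  elim: r => [|a r IH] [|c] //=; first exact: leq_addr.
  exact: leq_trans (IH c) (leq_addl _ _).
- move=> e; rewrite inE => /eqP-> /=.
  split=> [c r|c c' r|c _|r|c r|c] //=; rewrite ?none ?zero //.
  by rewrite leqn0 => ->.
- by move=> e e' c; rewrite !inE => /eqP-> /eqP->.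
- by move=> <-.
Qed.

Lemma hrun_inv : hinv hrun /\ hrun.2.1 = T.
Proof.
have gen (l : seq bool) : let st := foldl (fun st _ => tick st) hinit l in
    hinv st /\ (st.2.1 < T -> size l <= progress st).
  elim/last_ind: l => [|l a [h1 h2]] /=; first by split; [exact: hinit_inv|].
  rewrite foldl_rcons size_rcons; set st := foldl _ _ _ in h1 h2 *.
  case: (ltnP st.2.1 T) => lt_s.
    have [h3 h4] := tick_inv h1 lt_s; split=> // _.
    by apply: leq_ltn_trans h4; exact: h2.
  by rewrite /tick lt_s; split=> //; rewrite ltnNge lt_s.
have [h1 h2] := gen fuel; rewrite -/hrun in h1 h2; split=> //.
apply/eqP; rewrite eqn_leq (inv_s h1) leqNgt; apply/negP => lt_s.
have := h2 lt_s; rewrite /progress.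
have -> : size fuel = T * T.
  have E (l : seq bool) : size (flatten (map (fun=> rT) l)) = size l * T.
    by elim: l => //= _ l IH; rewrite size_cat IH mulSn.
  exact: E.
have : size (map fst hrun.2.2.2) <= hrun.2.1.+1.
  have /andP[uS aS] := inv_S h1.
  rewrite -[X in _ <= X](size_iota 0); apply: uniq_leq_size => // r /(allP aS).
  by rewrite mem_iota add0n ltnS.
rewrite size_map; move: (size hrun.2.2.2) hrun.2.1 lt_s => n s lt_s le_n.
have : s.+1 * T <= T * T by rewrite leq_mul2r lt_s orbT.
by rewrite mulSn; case: n le_n => [|n] /=; lia.
Qed.

Theorem hungarianP (m := nth None hungarian) :
  [/\ forall c t, m c = Some t -> c < C /\ t < T,
      forall c c' t, m c = Some t -> m c' = Some t -> c = c' &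
      forall m' : nat -> option nat,
        (forall c t, c < C -> m' c = Some t -> t < T) ->
        (forall c c' t, c < C -> c' < C -> m' c = Some t -> m' c' = Some t -> c = c') ->
        \sum_(c < C) oapp (wt^~ c) 0 (m' c) <= \sum_(c < C) oapp (wt^~ c) 0 (m c)].
Proof.
have [h1 h2] := hrun_inv.
rewrite /m /hungarian; have := inv_end h1 h2.
case E: hrun.2.2.2 => [|[t m0] [|//]] //= -[et].
have := inv_good h1 (e := (t, m0)); rewrite E mem_head et h2 => /(_ isT) /= g.
split.
- move=> c r /(match_tight g)[lt_c le_r ne _]; split=> //.
  by rewrite ltn_neqAle ne.
- by move=> c c' r e1 e2; exact: (match_inj g e1 e2).
- by move=> m' hm' im'; apply: good_optimal g hm' im'; exact: inv_cover h1.
Qed.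

End Hungarian.

(** * The Hungarian method runs in polynomial time *)

Lemma FP_memn X (cX : Code X) (s : X -> seq nat) (x : X -> nat) :
  FP s -> FP x -> FP (fun y => memn (s y) (x y)).
Proof. by move=> hs hx; rewrite /memn; fp. Qed.

Lemma FP_best X (cX : Code X) (l : X -> seq candidate) :
  FP l -> FP (fun x => best (l x)).
Proof.
move=> hl; rewrite /best; have [sl _] := hl.
apply: (FP_foldl (B := fun x => sz cand0 + sz (l x))).
- by [].
- by fp.
- by fp.
- by polyb.
move=> x k; set b := head _ _; have hb : sz b <= sz cand0 + sz (l x).
  rewrite /b; case: (l x) => [|a s]; first exact: leq_addr.
  by rewrite (sz_cons a) /=; lia.
have gen (s : seq candidate) (b0 : candidate) M : sz b0 <= M -> sz s <= M ->
    sz (foldl (fun b x : candidate => if x.1 <= b.1 then x else b) b0 s) <= M.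
  elim: s b0 => //= a s IH b0 h0; rewrite (sz_cons a) => hs.
  by apply: IH; [case: ifP => // _|]; lia.
by apply: gen => //; apply: leq_trans (sz_take _ _) (leq_addl _ _).
Qed.

Ltac fp_arith ::= lazymatch goal with
  | |- FP (fun y => memn (@?s y) (@?x y)) => apply: (@FP_memn _ _ s x)
  | |- FP (fun y => best (@?l y)) => apply: (@FP_best _ _ l)
  end.

Lemma FP_candidates X (cX : Code X) (W : X -> seq (seq nat)) (rI : X -> seq bool)
    (st : X -> hstate) :
  FP W -> FP rI -> FP st -> FP (fun x => candidates (W x) (rI x) (st x)).
Proof. by move=> hW hI hst; rewrite /candidates /wt; fp. Qed.

Ltac fp_arith ::= lazymatch goal with
  | |- FP (fun y => memn (@?s y) (@?x y)) => apply: (@FP_memn _ _ s x)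
  | |- FP (fun y => best (@?l y)) => apply: (@FP_best _ _ l)
  | |- FP (fun x => candidates (@?W x) (@?rI x) (@?st x)) =>
      apply: (@FP_candidates _ _ W rI st)
  end.

Lemma FP_tick X (cX : Code X) (W : X -> seq (seq nat)) (rT rI : X -> seq bool)
    (st : X -> hstate) :
  FP W -> FP rT -> FP rI -> FP st -> FP (fun x => tick (W x) (rT x) (rI x) (st x)).
Proof.
move=> hW hT hI hst; rewrite /tick /tick_with /new_u /new_v.
by rewrite /reach /restart /new_match; fp.
Qed.

(** Size of a state after [k] steps, for any table of weights. *)
Definition hbound (nT nI E k : nat) (st : hstate) : Prop :=
  [/\ size st.1.1 <= nT /\ all (fun x => x < 2 ^ E) st.1.1,
      size st.1.2 <= nI /\ all (fun x => x < 2 ^ E) st.1.2,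
      st.2.1 <= nT,
      size st.2.2.1 <= k /\ all (fun c => c <= nI) st.2.2.1 &
      size st.2.2.2 <= k.+1 /\
      all (fun e => [&& e.1 <= nT, size e.2 <= nI &
             all (fun o => oapp (fun t => t <= nT) true o) e.2]) st.2.2.2].

Lemma nth_lt_exp s E i : all (fun x => x < 2 ^ E) s -> nth 0 s i < 2 ^ E.
Proof.
move=> /allP h; case: (ltnP i (size s)) => hi; first by apply: h; apply: mem_nth.
by rewrite nth_default // expn_gt0.
Qed.

(** A slack is at most the sum of two potentials, so that a step multiplies the
    greatest potential by at most 4: it adds two bits. *)
Lemma tick_hbound W rT rI E k st :
  hbound (size rT) (size rI) E k st ->
  hbound (size rT) (size rI) E.+2 k.+1 (tick W rT rI st).
Proof.
move=> [[su hu] [sv hv] hs [sK hK] [st_ ht]].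
have le_E : 2 ^ E <= 2 ^ E.+2 by rewrite leq_exp2l //; lia.
have weak s : all (fun x => x < 2 ^ E) s -> all (fun x => x < 2 ^ E.+2) s.
  by apply: sub_all => x /leq_trans; apply.
rewrite /tick; case: leqP => [_|lt_s].
  by split=> //; split=> //; first [exact: weak | exact: leqW].
set b := best _.
have hb : [/\ b.1 < 2 ^ E.+1, oapp (fun c => c < size rI) true b.2.1 &
   [&& b.2.2.1 <= size rT, size b.2.2.2 <= size rI &
      all (fun o => oapp (fun t => t <= size rT) true o) b.2.2.2]].
  have [e|ne] := eqVneq (candidates W rI st) [::].
    by rewrite /b e; split; rewrite /= ?expn_gt0.
  have [hb _] := bestP ne; rewrite -/b in hb.
  have U r := nth_lt_exp r hu; have V r := nth_lt_exp r hv.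
  case/candidatesP: hb => e he [->|[c [lt_c _ ->]]] /=; split=> //;
    try exact: (allP ht).
    by apply: leq_trans (U e.1) _; rewrite expnS; lia.
  apply: leq_ltn_trans (leq_subr _ _) _; rewrite expnS mul2n -addnn -addnS.
  by rewrite leq_add // ltnW.
have [hb1 hb2 /and3P[hb3 hb4 hb5]] := hb.
have hm c : all (fun o => oapp (fun t => t <= size rT) true o)
    (new_match rI b.2.2.2 c b.2.2.1).
  apply/(all_nthP None) => i; rewrite size_mkseq => hi; rewrite nth_mkseq //.
  case: eqP => // _; case: (ltnP i (size b.2.2.2)) => hi'; last by rewrite nth_default.
  exact: (allP hb5 _ (mem_nth _ hi')).
have hu' : size (new_u rT st b.1) <= size rT /\
    all (fun x => x < 2 ^ E.+2) (new_u rT st b.1).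
  rewrite size_mkseq; split=> //; apply/(all_nthP 0) => i; rewrite size_mkseq => hi.
  rewrite nth_mkseq //; have U := nth_lt_exp i hu.
  by case: ifP => _; apply: leq_trans le_E; rewrite // (leq_ltn_trans (leq_subr _ _)).
have hv' : size (new_v rI st b.1) <= size rI /\
    all (fun x => x < 2 ^ E.+2) (new_v rI st b.1).
  rewrite size_mkseq; split=> //; apply/(all_nthP 0) => i; rewrite size_mkseq => hi.
  rewrite nth_mkseq //; have V := nth_lt_exp i hv.
  case: ifP => _; last exact: leq_trans le_E.
  by move: hb1; rewrite !expnS; lia.
rewrite /tick_with; case eb: b.2.1 hb2 => [c|] /= lt_c; last first.
  by split=> //=; split=> //=; rewrite lt_s hb4 hb5.
rewrite /reach; case er: (nth None b.2.2.2 c) => [r|] /=; last first.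
  by split=> //=; split=> //=; rewrite lt_s size_mkseq leqnn hm.
split=> //=; split=> //=; first by rewrite (ltnW lt_c).
rewrite size_mkseq leqnn hm ht !andbT.
case: (ltnP c (size b.2.2.2)) => hc; last by rewrite nth_default in er.
by have := allP hb5 _ (mem_nth None hc); rewrite er.
Qed.

Section ListBounds.
Context {A : eqType} {cA : Code A}.

Lemma sz_all (p : pred A) M (s : seq A) :
  all p s -> (forall x, p x -> sz x <= M) -> sz s <= size s * M.+1 + 1.
Proof.
move=> /allP h hM; rewrite -{1}[s]map_id; apply: sz_map_le => i hi a0.
by apply: hM; apply: h; apply: mem_nth.
Qed.

End ListBounds.

Lemma hbound_sz nT nI E k st : hbound nT nI E k st ->
  let a := 4 * nT + 1 in
  sz st <= (nT * (4 * E + 1).+1 + 1) + (nI * (4 * E + 1).+1 + 1) + a +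
     (k * (4 * nI + 1).+1 + 1) +
     (k.+1 * (a + (nI * (a + 2).+1 + 1) + 1).+1 + 1) + 4.
Proof.
case=> [[su hu] [sv hv] hs [sK hK] [st_ ht]]; set a := 4 * nT + 1 => /=.
have szn m n : m <= n -> sz m <= 4 * n + 1.
  by move=> le; apply: sz_nat_lt; apply: leq_ltn_trans le (ltn_expl _ _).
rewrite !sz_pair.
have h1 : sz st.1.1 <= nT * (4 * E + 1).+1 + 1.
  apply: leq_trans (sz_all hu (M := 4 * E + 1) _) _; first by move=> x; exact: sz_nat_lt.
  by rewrite leq_add2r leq_mul2r su orbT.
have h2 : sz st.1.2 <= nI * (4 * E + 1).+1 + 1.
  apply: leq_trans (sz_all hv (M := 4 * E + 1) _) _; first by move=> x; exact: sz_nat_lt.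
  by rewrite leq_add2r leq_mul2r sv orbT.
have h3 : sz st.2.1 <= a by exact: szn.
have h4 : sz st.2.2.1 <= k * (4 * nI + 1).+1 + 1.
  apply: leq_trans (sz_all hK (M := 4 * nI + 1) _) _; first by move=> x; exact: szn.
  by rewrite leq_add2r leq_mul2r sK orbT.
have h5 : sz st.2.2.2 <= k.+1 * (a + (nI * (a + 2).+1 + 1) + 1).+1 + 1.
  apply: leq_trans (sz_all ht (M := a + (nI * (a + 2).+1 + 1) + 1) _) _; last first.
    by rewrite leq_add2r leq_mul2r st_ orbT.
  move=> e /and3P[he1 he2 he3]; rewrite sz_pair addn1 ltnS.
  apply: leq_add; first exact: szn.
  apply: leq_trans (sz_all he3 (M := a + 2) _) _; last first.
    by rewrite leq_add2r leq_mul2r he2 orbT.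
  case=> [t|] //= ht'; last by rewrite addn2.
  have h : sz t <= a by exact: szn.
  by rewrite /sz /= addn1 addn2 !ltnS; exact: h.
move: (nT * _) (nI * _) (k * _) (k.+1 * _) h1 h2 h3 h4 h5 => *; lia.
Qed.

Lemma FP_hungarian X (cX : Code X) (W : X -> seq (seq nat)) (rT rI : X -> seq bool) :
  FP W -> FP rT -> FP rI -> FP (fun x => hungarian (W x) (rT x) (rI x)).
Proof.
move=> hW hT hI; have hfuel : FP (fun x => fuel (rT x)) by rewrite /fuel; fp.
have hr : FP (fun x => hrun (W x) (rT x) (rI x)); last first.
  by rewrite /hungarian; fp; exact: hr.
have [sW _] := hW; have [sT _] := hT; have [sI _] := hI; have [sF _] := hfuel.
pose a x := 4 * @sz _ (code_seq code_bool) (rT x) + 1.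
pose k x := @sz _ (code_seq code_bool) (fuel (rT x)).
pose E x := @sz _ (code_seq (code_seq code_nat)) (W x) + 2 * k x.
pose t x := @sz _ (code_seq code_bool) (rT x).
pose c x := @sz _ (code_seq code_bool) (rI x).
pose B x := (t x * (4 * E x + 1).+1 + 1) + (c x * (4 * E x + 1).+1 + 1) + a x +
     (k x * (4 * c x + 1).+1 + 1) +
     ((k x).+1 * (a x + (c x * (a x + 2).+1 + 1) + 1).+1 + 1) + 4.
rewrite /hrun; apply: (FP_foldl (B := B)).
- by [].
- by rewrite /hinit; fp.
- by apply: FP_tick; fp.
- by rewrite /B /t /c /E /a /k; polyb.
move=> x n.
have gen (l : seq bool) :
    hbound (size (rT x)) (size (rI x)) (sz (W x) + 2 * size l) (size l)
      (foldl (fun st _ => tick (W x) (rT x) (rI x) st) (hinit (W x) (rT x) (rI x)) l).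
  elim/last_ind: l => [|l b IH]; last first.
    rewrite foldl_rcons size_rcons; have := tick_hbound (W x) IH.
    by rewrite mulnS addnCA add2n.
  rewrite /hinit; split=> //=; split=> //; rewrite ?size_mkseq //.
  - apply/(all_nthP 0) => i; rewrite size_mkseq => hi; rewrite nth_mkseq // muln0 addn0.
    apply: leq_trans (sumn_lt_sz _) _; rewrite leq_exp2l //.
    case: (ltnP i (size (W x))) => hi'; first exact: ltnW (sz_nth_lt _ hi').
    rewrite nth_default //; exact: sz_gt0.
  - apply/(all_nthP 0) => i; rewrite size_mkseq => hi; rewrite nth_mkseq //.
    by rewrite expn_gt0.
  - rewrite ?leqnn ?andbT /=.
    by apply/(all_nthP None) => i; rewrite size_mkseq => hi; rewrite nth_mkseq.
have hn : size (take n (fuel (rT x))) <= k x.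
  by apply: leq_trans (ltnW (size_le_sz _)) (sz_take _ _).
apply: leq_trans (hbound_sz (gen _)) _.
set m := size (take _ _) in hn *.
have hT' : size (rT x) <= t x by exact: (ltnW (size_le_sz _)).
have hI' : size (rI x) <= c x by exact: (ltnW (size_le_sz _)).
have hE : sz (W x) + 2 * m <= E x by rewrite /E leq_add2l leq_mul2l hn orbT.
have ha : 4 * size (rT x) + 1 <= a x by rewrite /a leq_add2r leq_mul2l hT' orbT.
rewrite /B; move: (t x) (c x) (a x) (E x) (k x) hT' hI' hE ha hn => t0 c0 a0 E0 k0.
move=> hT' hI' hE ha hn.
by repeat first [assumption | apply: leqnn | apply: leq_add | apply: leq_mul
                | rewrite ltnS].
Qed.

(** * The value of a policy *)

Import Order.TTheory GRing.Theory Num.Theory.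

Section LastUse.
Variables (b : nat -> bool) (d u : nat -> rat) (N : nat).

Fixpoint last_use (n : nat) : option nat :=
  if n is n'.+1 then if b n' then Some n' else last_use n' else None.

Lemma last_useP n t : last_use n = Some t -> t < n /\ b t.
Proof.
elim: n => //= n IH; case: ifP => [bn [<-]|_ /IH[lt_t bt]] //.
by split=> //; exact: leqW.
Qed.

Lemma last_use_uniq n t : t < n -> b t -> (forall s, b s -> s = t) ->
  last_use n = Some t.
Proof.
move=> lt_t bt uni; elim: n lt_t => //= n IH lt_t.
case: ifP => [/uni-> //|bn]; apply: IH.
by move: lt_t; rewrite ltnS leq_eqVlt => /orP[/eqP et|//]; rewrite -et bt in bn.
Qed.

Lemma last_use_none n : (forall s, b s = false) -> last_use n = None.
Proof. by move=> h; elim: n => //= n ->; rewrite h. Qed.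

Local Open Scope ring_scope.

Hypotheses (u0 : u 0 = 0)
  (uS : forall n, (n < N)%N -> u n.+1 = (1 - (b n)%:R) * (u n + d n)).

(** A visit collects all the demand accumulated since the previous one, so that
    the visits collect together all the demand up to the last one. *)
Lemma collected n : (n <= N)%N ->
  \sum_(t < n) (b t)%:R * (u t + d t) =
  oapp (fun t => \sum_(s < t.+1) d s) 0 (last_use n).
Proof.
pose D k := \sum_(s < k) d s.
move=> le_n; have [//] : \sum_(t < n) (b t)%:R * (u t + d t) =
    oapp (fun t => D t.+1) 0 (last_use n) /\
    u n = D n - oapp (fun t => D t.+1) 0 (last_use n).
elim: n le_n => [|n IH] le_n; first by rewrite /D !big_ord0 u0 subr0.
have [e1 e2] := IH (ltnW le_n); have DS : D n.+1 = D n + d n.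
  by rewrite /D big_ord_recr.
rewrite big_ord_recr /= e1 uS // e2 /=; case: (b n) => /=.
  by rewrite mul1r subrr mul0r subrr DS addrA addrCA subrr addr0.
by rewrite mul0r addr0 subr0 mul1r DS addrAC.
Qed.

End LastUse.

Section Objective.
Local Open Scope ring_scope.
Variables (P : dflp).
Hypothesis loyalP : loyal P.

Definition used (y : policy P) (i : 'I_(nI P)) (t : nat) : bool :=
  oapp (y i) false (insub t).

Definition dem (j : 'I_(nJ P)) (t : nat) : rat := oapp (demand P j) 0 (insub t).

Lemma usedE y i (t : 'I_(nT P)) : used y i t = y i t.
Proof. by rewrite /used valK. Qed.

Lemma demE j (t : 'I_(nT P)) : dem j t = demand P j t.
Proof. by rewrite /dem valK. Qed.

Definition last_period (y : policy P) i : option nat := last_use (used y i) (nT P).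

(** What the visits of [i] are worth together when the last one is in period
    [t]. *)
Definition value (t : nat) (i : 'I_(nI P)) : rat :=
  reward i * \sum_(j < nJ P) (attend P i j)%:R * \sum_(s < t.+1) dem j s.

Lemma loyal_served y (t : 'I_(nT P)) i j : attend P i j -> served y t j = y i t.
Proof.
move=> aij; have := loyalP j; rewrite (bigD1 i) //= aij add1n => -[/eqP].
rewrite sum_nat_eq0 => /forallP others.
rewrite /served (bigD1 i) //= aij mul1n big1 ?maxn0 // => i' ne.
by have := others i'; rewrite ne /= => /eqP->.
Qed.

Lemma objectiveE y :
  objective y = \sum_(i < nI P) oapp (value^~ i) 0 (last_period y i).
Proof.
rewrite /objective exchange_big /=; apply: eq_bigr => i _.
rewrite exchange_big /=.
have valE o : oapp (value^~ i) 0 o = \sum_(j < nJ P)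
    reward i * ((attend P i j)%:R * oapp (fun t => \sum_(s < t.+1) dem j s) 0 o).
  case: o => [t|] /=; first by rewrite /value mulr_sumr.
  by rewrite big1 // => j _; rewrite !mulr0.
rewrite valE; apply: eq_bigr => j _.
have [aij|_] := boolP (attend P i j); last first.
  by rewrite big1 => [|t _]; rewrite !(mulr0, mul0r).
have uS n : (n < nT P)%N -> unmet y j n.+1 =
    (1 - (used y i n)%:R) * (unmet y j n + dem j n).
  move=> lt_n /=; rewrite insubT /used /dem insubT /=.
  by rewrite (loyal_served _ _ aij).
rewrite -(@collected (used y i) (dem j) (unmet y j) (nT P)) //.
rewrite mul1r mulr_sumr; apply: eq_bigr => t _.
by rewrite usedE demE mulr1 -mulrA.
Qed.

Definition matching_policy (m : nat -> option nat) : policy P :=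
  \matrix_(i, t) (m i == Some (t : nat)).

Variables (w : nat -> nat -> nat) (q : rat).
Hypotheses (q_gt0 : 0 < q)
  (wE : forall t (i : 'I_(nI P)), (t < nT P)%N -> (w t i)%:R = q * value t i).

(** The last periods of the locations are a matching, and a matching is the
    matching of the last periods of a policy that visits every location at most
    once. *)
Lemma matching_optimal (m : nat -> option nat) :
  (forall c t, m c = Some t -> c < nI P /\ t < nT P)%N ->
  (forall c c' t, m c = Some t -> m c' = Some t -> c = c') ->
  (forall m' : nat -> option nat,
     (forall c t, c < nI P -> m' c = Some t -> t < nT P)%N ->
     (forall c c' t, (c < nI P)%N -> (c' < nI P)%N ->
        m' c = Some t -> m' c' = Some t -> c = c') ->
     \sum_(c < nI P) oapp (w^~ c) 0%N (m' c) <=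
       \sum_(c < nI P) oapp (w^~ c) 0%N (m c))%N ->
  optimal (matching_policy m).
Proof.
move=> lt_m inj_m opt_m; split=> [t|y fy].
  have [i /eqP e|none] := pickP (fun i : 'I_(nI P) => m i == Some (t : nat)); last first.
    by rewrite big1 // => i _; rewrite mxE none.
  rewrite (bigD1 i) //= mxE e eqxx big1 // => i' ne; rewrite mxE.
  case: eqP => // e'; case/eqP: ne; apply: val_inj; exact: inj_m e' e.
have lastE i : last_period (matching_policy m) i = m i.
  rewrite /last_period; case e: (m i) => [t|]; last first.
    apply: last_use_none => s; rewrite /used; case: insubP => //= s' _ _.
    by rewrite mxE e.
  have [_ lt_t] := lt_m _ _ e; apply: last_use_uniq => //.
    by rewrite /used insubT /= mxE e eqxx.
  move=> s; rewrite /used; case: insubP => //= s' _ <-.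
  by rewrite mxE e => /eqP[].
have sumE (n : nat -> option nat) :
    (forall i t, i < nI P -> n i = Some t -> t < nT P)%N ->
    q * \sum_(i < nI P) oapp (value^~ i) 0 (n i) =
    (\sum_(i < nI P) oapp (w^~ i) 0%N (n i))%:R.
  move=> lt_n; rewrite natr_sum mulr_sumr; apply: eq_bigr => i _.
  by case e: (n i) => [t|] /=; rewrite ?mulr0 // wE // (lt_n _ _ _ e).
pose m' i := oapp (last_period y) None (insub i).
have m'E (i : 'I_(nI P)) : m' i = last_period y i by rewrite /m' valK.
rewrite !objectiveE -(ler_pM2l q_gt0).
have -> : \sum_i oapp (value^~ i) 0 (last_period y i) =
          \sum_(i < nI P) oapp (value^~ i) 0 (m' i).
  by apply: eq_bigr => i _; rewrite m'E.
have -> : \sum_i oapp (value^~ i) 0 (last_period (matching_policy m) i) =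
          \sum_(i < nI P) oapp (value^~ i) 0 (m i).
  by apply: eq_bigr => i _; rewrite lastE.
have m'P c t : (c < nI P)%N -> m' c = Some t -> exists2 i : 'I_(nI P), i = c :> nat &
    exists2 t' : 'I_(nT P), t' = t :> nat & y i t'.
  move=> lt_c; rewrite /m' insubT /= => /last_useP[lt_t]; rewrite /used insubT /= => yt.
  by exists (Sub c lt_c) => //; exists (Sub t lt_t).
rewrite !sumE ?ler_nat; last 2 first.
- by move=> i t _ /lt_m[].
- by move=> c t lt_c /(m'P c t lt_c)[i _ [t' <- _]].
apply: opt_m => [c t lt_c /(m'P c t lt_c)[i _ [t' <- _]] //|c c' t lt_c lt_c'].
move=> /(m'P _ _ lt_c)[i <- [t1 e1 y1]] /(m'P _ _ lt_c')[i' <- [t2 e2 y2]].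
have et : t2 = t1 by apply: val_inj; rewrite /= e1 e2.
have := fy t1; rewrite (bigD1 i) //= y1; case: (eqVneq i' i) => [-> //|ne].
by rewrite (bigD1 i') //= -et y2.
Qed.

End Objective.

(** * Reading an instance *)

(** A state [(done, (digit, (ds, rest)))] of an automaton that reads a number:
    [digit] tells that the next bit is a digit.  The digits read so far, and the
    bits that come after the number, are in reverse order. *)
Definition pstate := (bool * (bool * (seq bool * seq bool)))%type.

Definition nat_step (st : pstate) (b : bool) : pstate :=
  if st.1 then (true, (false, (st.2.2.1, b :: st.2.2.2)))
  else if st.2.1 then (false, (false, (b :: st.2.2.1, [::])))
  else (~~ b, (b, (st.2.2.1, [::]))).

Definition nat_scan (w : seq bool) : pstate :=
  foldl nat_step (false, (false, ([::], [::]))) w.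

Definition parse_nat (w : seq bool) : nat * seq bool :=
  (bval (rev (nat_scan w).2.2.1), rev (nat_scan w).2.2.2).

Definition unary_step (st : pstate) (b : bool) : pstate :=
  if st.1 then (true, (false, (st.2.2.1, b :: st.2.2.2)))
  else if b then (false, (false, (true :: st.2.2.1, [::])))
  else (true, (false, (st.2.2.1, [::]))).

Definition unary_scan (w : seq bool) : pstate :=
  foldl unary_step (false, (false, ([::], [::]))) w.

Definition parse_unary (w : seq bool) : seq bool * seq bool :=
  ((unary_scan w).2.2.1, rev (unary_scan w).2.2.2).

Definition parse_rat (w : seq bool) : (nat * nat) * seq bool :=
  let p := parse_nat w in let q := parse_nat p.2 in ((p.1, q.1), q.2).

(** The number of rationals to read is the length of [l]. *)
Definition parse_rats (l w : seq bool) : seq (nat * nat) * seq bool :=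
  let r := foldl (fun st _ => let p := parse_rat st.2 in (p.1 :: st.1, p.2))
             ([::], w) l in
  (rev r.1, r.2).

Definition scale_step (st : seq nat * nat) (f : nat * nat) : seq nat * nat :=
  (map (fun a => a * f.2) st.1 ++ [:: f.1 * st.2], st.2 * f.2).

(** Numerators over a common denominator, which is the product of all the
    denominators: its length in binary is at most the sum of theirs. *)
Definition scale (l : seq (nat * nat)) : seq nat * nat :=
  foldl scale_step ([::], 1) l.

Lemma nat_scan_done ds r s :
  foldl nat_step (true, (false, (ds, r))) s = (true, (false, (ds, rev s ++ r))).
Proof. by elim: s r => //= b s IH r; rewrite IH rev_cons cat_rcons. Qed.

Lemma parse_natE n s : parse_nat (enc_nat n ++ s) = (n, s).
Proof.
have gen l ds : foldl nat_step (false, (false, (ds, [::])))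
    (rcons (flatten [seq [:: true; b] | b <- l]) false ++ s) =
    (true, (false, (rev l ++ ds, rev s))).
  elim: l ds => [|b l IH] ds /=; first by rewrite nat_scan_done cats0.
  by rewrite IH rev_cons cat_rcons.
by rewrite /parse_nat /nat_scan gen /= cats0 !revK bval_digits.
Qed.

Lemma parse_unaryE n s : parse_unary (enc_unary n ++ s) = (nseq n true, s).
Proof.
have don ds r t : foldl unary_step (true, (false, (ds, r))) t =
    (true, (false, (ds, rev t ++ r))).
  by elim: t r => //= b t IH r; rewrite IH rev_cons cat_rcons.
have gen k ds : foldl unary_step (false, (false, (ds, [::])))
    (rcons (nseq k true) false ++ s) = (true, (false, (nseq k true ++ ds, rev s))).
  elim: k ds => [|k IH] ds /=; first by rewrite don cats0.
  by rewrite IH; elim: (k) => //= k' [->].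
by rewrite /parse_unary /unary_scan gen /= cats0 !revK.
Qed.

Definition frac (q : rat) : nat * nat := (`|numq q|%N, `|denq q|%N).

Lemma parse_ratsE l (qs : seq rat) s : size l = size qs ->
  parse_rats l (flatten [seq enc_rat q | q <- qs] ++ s) = (map frac qs, s).
Proof.
move=> hs; rewrite /parse_rats; set step := fun st : _ * _ => _.
suff gen acc : foldl step (acc, flatten [seq enc_rat q | q <- qs] ++ s) l =
    (rev (map frac qs) ++ acc, s) by rewrite gen /= cats0 revK.
elim: l qs hs acc => [|b l IH] [|q qs] //= [hs] acc.
by rewrite /step /parse_rat /enc_rat -!catA !parse_natE /= IH // rev_cons cat_rcons.
Qed.

Section Scale.
Local Open Scope ring_scope.
Import Order.TTheory GRing.Theory Num.Theory.

Lemma scaleE (qs : seq rat) : all (fun q => 0 <= q) qs ->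
  let r := scale (map frac qs) in
  (0 < r.2)%N /\ [seq a%:R | a <- r.1] = [seq q * r.2%:R | q <- qs].
Proof.
rewrite /scale; elim/last_ind: qs => [|qs q IH] //=.
rewrite all_rcons => /andP[q0 /IH]; rewrite map_rcons foldl_rcons.
set r := foldl _ _ _ => -[r0 hr]; rewrite /scale_step /=.
have d0 : (0 < `|denq q|)%N by rewrite absz_gt0 denq_neq0.
split; first by rewrite muln_gt0 r0.
have num : (`|numq q|%N)%:R = q * (`|denq q|%N)%:R :> rat.
  by rewrite !natr_absz ger0_norm ?numq_ge0 // gtr0_norm ?denq_gt0 // numqE.
rewrite map_cat map_rcons -cats1; congr (_ ++ _).
  rewrite -map_comp.
  transitivity [seq a * (`|denq q|%N)%:R | a <- [seq a%:R : rat | a <- r.1]].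
    by rewrite -map_comp; apply: eq_map => a /=; rewrite natrM.
  by rewrite hr -map_comp; apply: eq_map => a /=; rewrite natrM mulrA.
by rewrite /= !natrM num mulrAC -mulrA.
Qed.

Lemma nth_scale (qs : seq rat) k : all (fun q => 0 <= q) qs ->
  (nth 0%N (scale (map frac qs)).1 k)%:R =
  nth 0 qs k * (scale (map frac qs)).2%:R :> rat.
Proof.
move=> /scaleE[_ h].
case: (ltnP k (size qs)) => hk; last first.
  rewrite [nth 0 qs k]nth_default // mul0r nth_default //.
  by have := congr1 size h; rewrite !size_map => ->.
rewrite -(nth_map 0 0 (fun q => q * _)) // -h (nth_map 0%N) //.
by have := congr1 size h; rewrite !size_map => ->.
Qed.

End Scale.

(** The automata store each bit at most once. *)
Lemma scan_size (step : pstate -> bool -> pstate) w :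
  (forall st b, size (step st b).2.2.1 + size (step st b).2.2.2 <=
     (size st.2.2.1 + size st.2.2.2).+1) ->
  let r := foldl step (false, (false, ([::], [::]))) w in
  size r.2.2.1 + size r.2.2.2 <= size w.
Proof.
move=> h; elim/last_ind: w => [|w b IH] //; rewrite foldl_rcons size_rcons.
exact: leq_trans (h _ _) _.
Qed.

Lemma nat_step_size st b : size (nat_step st b).2.2.1 + size (nat_step st b).2.2.2 <=
  (size st.2.2.1 + size st.2.2.2).+1.
Proof. by rewrite /nat_step; case: st.1; case: st.2.1 => /=; lia. Qed.

Lemma unary_step_size st b :
  size (unary_step st b).2.2.1 + size (unary_step st b).2.2.2 <=
  (size st.2.2.1 + size st.2.2.2).+1.
Proof. by rewrite /unary_step; case: st.1; case: b => /=; lia. Qed.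

Lemma FP_scan X (cX : Code X) (step : pstate -> bool -> pstate) (w : X -> seq bool) :
  (forall st b, size (step st b).2.2.1 + size (step st b).2.2.2 <=
     (size st.2.2.1 + size st.2.2.2).+1) ->
  FP (fun p : pstate * bool => step p.1 p.2) -> FP w ->
  FP (fun x => foldl step (false, (false, ([::], [::]))) (w x)).
Proof.
move=> hs hstep hw; have [sw _] := hw.
apply: (FP_foldl (B := fun x => 4 * sz (w x) + 20)) => //.
- by fp.
- apply: (FP_app2 (h := step)) => //; fp.
- by polyb.
move=> x k; have := @scan_size step (take k (w x)) hs.
set r := foldl _ _ _ => /= hr.
have hk : size (take k (w x)) <= sz (w x).
  by apply: leq_trans (ltnW (size_le_sz _)) (sz_take _ _).
have h1 : sz r.1 <= 3 by case: r.1.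
have h2 : sz r.2.1 <= 3 by case: r.2.1.
have h3 : sz r.2.2.1 <= 4 * size r.2.2.1 + 1 by exact: (proj2 (andP (sz_bits _))).
have h4 : sz r.2.2.2 <= 4 * size r.2.2.2 + 1 by exact: (proj2 (andP (sz_bits _))).
rewrite !sz_pair; lia.
Qed.

Lemma FP_parse_nat X (cX : Code X) (w : X -> seq bool) :
  FP w -> FP (fun x => parse_nat (w x)).
Proof.
move=> hw; have hs : FP (fun p : pstate * bool => nat_step p.1 p.2).
  by rewrite /nat_step; fp.
have h := FP_scan nat_step_size hs hw.
rewrite /parse_nat /nat_scan; apply: FP_pair; last first.
  by apply: FP_rev; apply: FP_snd_of; apply: FP_snd_of; apply: FP_snd_of.
apply: (FP_comp FP_bval).
by apply: FP_rev; apply: FP_fst_of; apply: FP_snd_of; apply: FP_snd_of.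
Qed.

Lemma FP_parse_unary X (cX : Code X) (w : X -> seq bool) :
  FP w -> FP (fun x => parse_unary (w x)).
Proof.
move=> hw; have hs : FP (fun p : pstate * bool => unary_step p.1 p.2).
  by rewrite /unary_step; fp.
have h := FP_scan unary_step_size hs hw.
rewrite /parse_unary /unary_scan; apply: FP_pair; last first.
  by apply: FP_rev; apply: FP_snd_of; apply: FP_snd_of; apply: FP_snd_of.
by apply: FP_fst_of; apply: FP_snd_of; apply: FP_snd_of.
Qed.

Ltac fp_arith ::= lazymatch goal with
  | |- FP (fun x => parse_nat (@?w x)) => apply: (@FP_parse_nat _ _ w)
  end.

Lemma parse_nat_size w : size (parse_nat w).2 <= size w /\ (parse_nat w).1 < 2 ^ size w.
Proof.
have := @scan_size nat_step w nat_step_size; rewrite -/(nat_scan w) /= => h.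
rewrite size_rev; split; first exact: leq_trans (leq_addl _ _) h.
apply: leq_trans (bval_lt _) _; rewrite size_rev leq_exp2l //.
exact: leq_trans (leq_addr _ _) h.
Qed.

Lemma FP_parse_rats X (cX : Code X) (l w : X -> seq bool) :
  FP l -> FP w -> FP (fun x => parse_rats (l x) (w x)).
Proof.
move=> hl hw; have [sl _] := hl; have [sw _] := hw.
pose step (st : seq (nat * nat) * seq bool) (_ : bool) :=
  let p := parse_rat st.2 in (p.1 :: st.1, p.2).
have h : FP (fun x => foldl step ([::], w x) (l x)); last first.
  rewrite /parse_rats -/step; apply: FP_pair; last exact: FP_snd_of h.
  by apply: FP_rev; exact: FP_fst_of h.
pose M x := 4 * @sz _ (code_seq code_bool) (w x) + 1.
apply: (FP_foldl (B := fun x => (sz (l x) * (2 * M x + 1).+1 + 1) + M x + 1)).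
- by [].
- by fp.
- by rewrite /step /parse_rat; fp.
- by rewrite /M; polyb.
move=> x k.
have gen (s : seq bool) : let r := foldl step ([::], w x) s in
    [/\ size r.1 = size s, size r.2 <= size (w x) &
      all (fun f => (f.1 < 2 ^ size (w x)) && (f.2 < 2 ^ size (w x))) r.1].
  elim/last_ind: s => [|s b [h1 h2 h3]] //; rewrite foldl_rcons size_rcons.
  set r := foldl _ _ _ in h1 h2 h3 *; rewrite /step /parse_rat /=.
  have [p1 p2] := parse_nat_size r.2.
  have [q1 q2] := parse_nat_size (parse_nat r.2).2.
  have le1 := leq_trans p1 h2.
  rewrite h1 h3 andbT; split=> //; first exact: leq_trans q1 le1.
  apply/andP; split.
    by apply: leq_trans p2 _; rewrite leq_exp2l.
  by apply: leq_trans q2 _; rewrite leq_exp2l.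
have [h1 h2 h3] := gen (take k (l x)); set r := foldl _ _ _ in h1 h2 h3 *.
have hk : size (take k (l x)) <= sz (l x).
  by apply: leq_trans (ltnW (size_le_sz _)) (sz_take _ _).
have hw' : size (w x) <= sz (w x) by exact: (ltnW (size_le_sz _)).
rewrite sz_pair addn1 ltnS; apply: leq_add.
  apply: leq_trans (sz_all h3 (M := 2 * M x + 1) _) _.
    move=> f /andP[/sz_nat_lt f1 /sz_nat_lt f2]; rewrite sz_pair addn1 ltnS /M.
    by move: f1 f2; set a := sz _; set b := sz f.2; lia.
  by rewrite leq_add2r leq_mul2r h1 hk orbT.
apply: leq_trans (proj2 (andP (sz_bits _))) _.
by rewrite /M leq_add2r leq_mul2l (leq_trans h2).
Qed.

Lemma FP_scale X (cX : Code X) (l : X -> seq (nat * nat)) :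
  FP l -> FP (fun x => scale (l x)).
Proof.
move=> hl; have [sl _] := hl; rewrite /scale.
pose M x := 4 * @sz _ (code_seq (code_prod code_nat code_nat)) (l x) + 1.
apply: (FP_foldl (B := fun x => (sz (l x) * (M x).+1 + 1) + M x + 1)).
- by [].
- by fp.
- by rewrite /scale_step; fp.
- by rewrite /M; polyb.
move=> x k.
have gen (s : seq (nat * nat)) : let r := foldl scale_step ([::], 1) s in
    [/\ size r.1 = size s, r.2 < 2 ^ sz s & all (fun a => a < 2 ^ sz s) r.1].
  elim/last_ind: s => [|s f [h1 h2 h3]] //; rewrite foldl_rcons size_rcons.
  set r := foldl _ _ _ in h1 h2 h3 *; rewrite /scale_step /=.
  have E : sz f + sz s <= sz (rcons s f).
    have e1 : (sz (s ++ [:: f])).+1 = sz s + sz [:: f] by exact: sz_cat.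
    have e2 : sz [:: f] = (sz f + 1).+1 by [].
    by rewrite -cats1; lia.
  have le_exp a b : a < 2 ^ sz s -> b < 2 ^ sz f -> a * b < 2 ^ sz (rcons s f).
    move=> ha hb; apply: (@leq_trans (2 ^ (sz f + sz s))); last by rewrite leq_exp2l.
    by rewrite expnD [X in _ < X]mulnC; apply: ltn_mul.
  have hf := ltn_2sz f.1; have hf2 := ltn_2sz f.2.
  have f1 : f.1 < 2 ^ sz f.
    by apply: leq_trans hf _; rewrite leq_exp2l // sz_pair; lia.
  have f2 : f.2 < 2 ^ sz f.
    by apply: leq_trans hf2 _; rewrite leq_exp2l // sz_pair; lia.
  split; first by rewrite size_cat size_map h1 addn1.
    exact: le_exp.
  rewrite all_cat all_map; apply/andP; split.
    by apply/allP => a /(allP h3) ha; exact: le_exp.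
  by rewrite /= andbT mulnC; exact: le_exp.
have [h1 h2 h3] := gen (take k (l x)); set r := foldl _ _ _ in h1 h2 h3 *.
have hk : size (take k (l x)) <= sz (l x).
  by apply: leq_trans (ltnW (size_le_sz _)) (sz_take _ _).
have hk' : sz (take k (l x)) <= sz (l x) by exact: sz_take.
have up n : n < 2 ^ sz (take k (l x)) -> sz n <= M x.
  by move=> /sz_nat_lt; rewrite /M; lia.
rewrite sz_pair addn1 ltnS; apply: leq_add; last exact: up.
apply: leq_trans (sz_all h3 up) _.
by rewrite leq_add2r leq_mul2r h1 hk orbT.
Qed.

(** * Solving an instance *)

(** The numbers of periods, of locations and of customers in unary, the scaled
    rewards followed by the scaled demands, and the willingness to attend. *)
Definition inst := (seq bool * (seq bool * (seq bool * (seq nat * seq bool))))%type.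

Definition read_header (w : seq bool) : seq bool * (seq bool * (seq bool * seq bool)) :=
  let p := parse_unary w in let q := parse_unary p.2 in
  (p.1, (q.1, parse_unary q.2)).

Definition read_tables (h : seq bool * (seq bool * (seq bool * seq bool))) : inst :=
  let r := parse_rats (h.2.1 ++ flatten (map (fun=> h.1) h.2.2.1)) h.2.2.2 in
  (h.1, (h.2.1, (h.2.2.1, ((scale r.1).1, r.2)))).

(** Weight of a last period [t] for a location [i]; the tables are listed row by
    row. *)
Definition weights (x : inst) : seq (seq nat) :=
  mkseq (fun t => mkseq (fun i => nth 0 x.2.2.2.1 i * sumn (mkseq (fun j =>
      if nth false x.2.2.2.2 (i * size x.2.2.1 + j) then
        sumn (mkseq (fun s => if s <= t
                              then nth 0 x.2.2.2.1 (size x.2.1 + (j * size x.1 + s))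
                              else 0) (size x.1))
      else 0) (size x.2.2.1))) (size x.2.1)) (size x.1).

Definition write_policy (x : inst) (m : matching) : seq bool :=
  flatten (mkseq (fun t => mkseq (fun i => oapp (fun r => r == t) false (nth None m i))
    (size x.2.1)) (size x.1)).

Definition solve_inst (x : inst) : seq bool :=
  write_policy x (hungarian (weights x) x.1 x.2.1).

Definition solve (w : seq bool) : seq bool := solve_inst (read_tables (read_header w)).

Ltac fp_arith ::= lazymatch goal with
  | |- FP (fun x => hungarian (@?W x) (@?rT x) (@?rI x)) =>
      apply: (@FP_hungarian _ _ W rT rI)
  | |- FP (fun x => parse_unary (@?w x)) => apply: (@FP_parse_unary _ _ w)
  | |- FP (fun x => parse_rats (@?l x) (@?w x)) => apply: (@FP_parse_rats _ _ l w)
  | |- FP (fun x => scale (@?l x)) => apply: (@FP_scale _ _ l)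
  end.

Lemma FP_solve : FP solve.
Proof.
have h1 : FP read_header by rewrite /read_header; fp.
have h2 : FP read_tables by rewrite /read_tables; fp.
have h3 : FP weights by rewrite /weights; fp.
have h4 : FP solve_inst by rewrite /solve_inst /write_policy; fp.
exact: FP_comp h4 (FP_comp h2 h1).
Qed.

Lemma map_enum_ord A (f : nat -> A) n : map (fun i : 'I_n => f i) (enum 'I_n) = mkseq f n.
Proof. by rewrite /mkseq -val_enum_ord -map_comp. Qed.

Lemma nth_allpairs A B D (d : D) (x0 : A) (y0 : B) (f : A -> B -> D) s t a b :
  a < size s -> b < size t ->
  nth d [seq f x y | x <- s, y <- t] (a * size t + b) = f (nth x0 s a) (nth y0 t b).
Proof.
elim: s a => // x s IH [|a] /= ha hb; rewrite nth_cat size_map.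
  by rewrite mul0n add0n hb (nth_map y0).
by rewrite mulSn -addnA ltnNge leq_addr /= addKn IH.
Qed.

Lemma nth_allpairs_ord D (d : D) m n (f : 'I_m -> 'I_n -> D) (i : 'I_m) (j : 'I_n) :
  nth d [seq f x y | x <- enum 'I_m, y <- enum 'I_n] (i * n + j) = f i j.
Proof.
have := @nth_allpairs _ _ _ d i j f (enum 'I_m) (enum 'I_n) i j.
by rewrite !size_enum_ord !nth_ord_enum; apply.
Qed.

Lemma sumn_mkseq f n : sumn (mkseq f n) = \sum_(i < n) f i.
Proof. by rewrite sumnE /mkseq big_map -[n in iota _ n]subn0 big_mkord. Qed.

Section Correct.
Variable P : dflp.

Definition all_rats : seq rat := [seq reward i | i <- enum 'I_(nI P)] ++
  [seq demand P j t | j <- enum 'I_(nJ P), t <- enum 'I_(nT P)].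

Definition inst_of : inst :=
  (nseq (nT P) true, (nseq (nI P) true, (nseq (nJ P) true,
    ((scale (map frac all_rats)).1,
     [seq attend P i j | i <- enum 'I_(nI P), j <- enum 'I_(nJ P)])))).

Lemma read_enc : read_tables (read_header (enc_dflp P)) = inst_of.
Proof.
have E s : flatten [seq enc_rat (reward i) | i <- enum 'I_(nI P)] ++
    flatten [seq enc_rat (demand P j t) |
              j <- enum 'I_(nJ P), t <- enum 'I_(nT P)] ++ s =
    flatten [seq enc_rat q | q <- all_rats] ++ s.
  by rewrite /all_rats map_cat flatten_cat -map_comp map_allpairs catA.
have H : read_header (enc_dflp P) = (nseq (nT P) true, (nseq (nI P) true,
    (nseq (nJ P) true, flatten [seq enc_rat q | q <- all_rats] ++
      [seq attend P i j | i <- enum 'I_(nI P), j <- enum 'I_(nJ P)]))).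
  by rewrite /read_header /enc_dflp !parse_unaryE E.
have R a b c d : read_tables (a, (b, (c, d))) =
    let r := parse_rats (b ++ flatten (map (fun=> a) c)) d in
    (a, (b, (c, ((scale r.1).1, r.2)))) by [].
rewrite H R (@parse_ratsE _ all_rats) //.
rewrite size_cat size_nseq size_cat size_map size_enum_ord size_allpairs !size_enum_ord.
congr (_ + _); elim: (nJ P) => //= n IH; rewrite size_cat IH size_nseq mulSn //.
Qed.

Local Open Scope ring_scope.
Import Order.TTheory GRing.Theory Num.Theory.

Lemma all_rats_ge0 : all (fun q => 0 <= q) all_rats.
Proof.
rewrite all_cat; apply/andP; split; apply/allP => q.
  by case/mapP => i _ ->; apply: ltW; apply: reward_gt0.
by case/allpairsP => -[j t] [_ _ ->]; apply: demand_ge0.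
Qed.

Let Q : rat := (scale (map frac all_rats)).2%:R.

(** Weights are products of a reward and a demand, hence the square of the
    common denominator. *)
Lemma weightE t (i : 'I_(nI P)) : (t < nT P)%N ->
  (wt (weights inst_of) t i)%:R = Q * Q * value t i.
Proof.
move=> lt_t; rewrite /wt /weights /inst_of /= !size_nseq !nth_mkseq //.
rewrite natrM nth_scale ?all_rats_ge0 // nth_cat size_map size_enum_ord ltn_ord.
rewrite (nth_map i) ?size_enum_ord // nth_ord_enum.
rewrite sumn_mkseq natr_sum /value -/Q.
rewrite [RHS]mulrCA -!mulrA; congr (_ * (_ * _)).
rewrite mulr_sumr; apply: eq_bigr => j _; rewrite nth_allpairs_ord.
case: (attend P i j) => /=; last by rewrite !(mul0r, mulr0).
rewrite mul1r sumn_mkseq natr_sum mulr_sumr.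
rewrite (big_ord_widen _ (fun s => Q * dem j s) lt_t) [RHS]big_mkcond /=.
apply: eq_bigr => s _; rewrite ltnS; case: (s <= t)%N => //.
rewrite nth_scale ?all_rats_ge0 // nth_cat size_map size_enum_ord.
by rewrite ltnNge leq_addr /= addKn nth_allpairs_ord mulrC demE.
Qed.

Lemma solve_optimal : loyal P ->
  exists2 y : policy P, optimal y & solve (enc_dflp P) = enc_policy y.
Proof.
move=> lP; rewrite /solve read_enc /solve_inst.
have [] := hungarianP (weights inst_of) inst_of.1 inst_of.2.1.
set m := hungarian _ _ _; rewrite /= !size_nseq => h1 h2 h3.
have [Q0 _] := scaleE all_rats_ge0.
exists (matching_policy P (nth None m)).
  apply: (matching_optimal lP (w := wt (weights inst_of)) (q := Q * Q)) => //.
    by rewrite mulr_gt0 // ltr0n.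
  exact: weightE.
rewrite /write_policy /enc_policy /= !size_nseq -map_enum_ord.
congr flatten; apply: eq_map => t; rewrite -map_enum_ord; apply: eq_map => i.
rewrite mxE; case: (nth None m i) => //= r; exact/idP/idP.
Qed.

End Correct.

Theorem theorem6 :
  polynomially_solvable loyal optimal enc_dflp enc_policy.
Proof.
have [M [p hM]] := FP_machine FP_solve.
exists M, p => P lP; have [hh ho] := hM (enc_dflp P).
split; first exact: hh.
have [y oy ey] := solve_optimal lP; exists y => //.
by rewrite -ey -ho.
Qed.
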